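(* If $G$ is a locally compact group with property (T), then $N_{\mathrm{amTr}}(G)=N_{\mathrm{MAP}}(G)$.
   Context: For a locally compact group $G$, $\mathrm{T}(G)$ is the set of continuous positive definite $u:G\to\mathbb{C}$ with $u(e)=1$ and $u(st)=u(ts)$ for all $s,t\in G$; for $u\in\mathrm{T}(G)$ put $N_u=u^{-1}(\{1\})$ and define $\tilde u:G\times G\to\mathbb{C}$ by $\tilde u(s,t)=u(st^{-1})$, which is positive definite. Let $\varpi=\bigoplus_{u}\pi_u^{\infty}$ be the universal representation of $G$: the direct sum, over all continuous positive definite $u$ with $u(e)=1$, of infinite ampliations of the GNS representations $\pi_u$. Let $\varpi\times\varpi$ be the Kronecker product representation $(s,t)\mapsto\varpi(s)\otimes\varpi(t)$ of $G\times G$, and let $\mathrm{P}_{\min}(G\times G)$ be the closure, in the topology of uniform convergence on compact sets, of the cone generated by the functions $\langle(\varpi\times\varpi)(\cdot,\cdot)\xi,\xi\rangle$, $\xi\in\mathcal{H}_\varpi\otimes\mathcal{H}_\varpi$ (it corresponds to the positive functionals on $C^*(G)\otimes_{\min}C^*(G)$). The amenable traces on $G$ are $\mathrm{T}_{\mathrm{am}}(G)=\{u\in\mathrm{T}(G):\tilde u\in\mathrm{P}_{\min}(G\times G)\}$, and $N_{\mathrm{amTr}}(G)=\bigcap_{u\in\mathrm{T}_{\mathrm{am}}(G)}N_u$. The von Neumann kernel $N_{\mathrm{MAP}}(G)$ is the intersection of all closed normal subgroups $N$ of $G$ for which $G/N$ is maximally almost periodic (its continuous finite-dimensional unitary representations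 separate points). *)

(* Defs.v *)
From HB Require Import structures.
From mathcomp Require Import all_boot all_order all_algebra.
From mathcomp Require Import generic_quotient sesquilinear spectral complex.
From mathcomp Require Import all_classical all_reals topology normedtype.

Set Implicit Arguments.
Unset Strict Implicit.
Unset Printing Implicit Defensive.

Import Order.TTheory GRing.Theory Num.Theory.
Import numFieldNormedType.Exports.

Local Open Scope classical_set_scope.
Local Open Scope ring_scope.

HB.mixin Record isTopologicalGroup G of Group G & Topological G := {
  mulg_continuous : continuous (fun p : G * G => (p.1 * p.2)%g);
  invg_continuous : continuous (fun x : G => (x^-1)%g)
}.

#[short(type="topGroupType")]
HB.structure Definition TopGroup :=
  {G of Group G & Topological G & isTopologicalGroup G}.

(* Locally compact groups are Hausdorff by convention. *)
Definition locally_compact_group (G : topGroupType) : Prop :=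
  hausdorff_space G /\ locally_compact [set: G].

Lemma cvg_mulg (G : topGroupType) (T : Type) (F : set_system T) (FF : Filter F)
  (f g : T -> G) (a b : G) :
  f @ F --> a -> g @ F --> b -> (f x * g x)%g @[x --> F] --> (a * b)%g.
Proof.
apply: (@continuous2_cvg _ _ _ _ F FF f g (fun x y : G => (x * y)%g)).
exact: (@mulg_continuous G (a, b)).
Qed.

Section ProductGroup.
Variables G H : topGroupType.
Local Open Scope group_scope.

Fact prodg_mulg_continuous :
  continuous (fun p : (G * H) * (G * H) => p.1 * p.2).
Proof.
move=> -[p q]; apply: cvg_pair; apply: cvg_mulg.
- exact: (@continuous_comp _ _ _ fst fst (p, q) cvg_fst cvg_fst).
- exact: (@continuous_comp _ _ _ snd fst (p, q) cvg_snd cvg_fst).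
- exact: (@continuous_comp _ _ _ fst snd (p, q) cvg_fst cvg_snd).
- exact: (@continuous_comp _ _ _ snd snd (p, q) cvg_snd cvg_snd).
Qed.

Fact prodg_invg_continuous : continuous (fun p : G * H => p^-1).
Proof.
move=> p; apply: cvg_pair.
- exact: (@continuous_comp _ _ _ fst (fun x : G => x^-1) p cvg_fst
            (@invg_continuous G _)).
- exact: (@continuous_comp _ _ _ snd (fun x : H => x^-1) p cvg_snd
            (@invg_continuous H _)).
Qed.

HB.instance Definition _ := isTopologicalGroup.Build (G * H)%type
  prodg_mulg_continuous prodg_invg_continuous.

End ProductGroup.

Record normalSubgroup (G : groupType) := NormalSubgroup {
  nsg_set :> set G;
  nsg1 : nsg_set 1%g;
  nsgM : forall x y, nsg_set x -> nsg_set y -> nsg_set (x * y)%g;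
  nsgV : forall x, nsg_set x -> nsg_set (x^-1)%g;
  nsgJ : forall x y, nsg_set x -> nsg_set (y^-1 * (x * y))%g
}.

Section QuotientGroup.
Variables (G : topGroupType) (N : normalSubgroup G).
Local Open Scope group_scope.
Local Open Scope quotient_scope.

Definition coset_rel : rel G := fun x y => `[< nsg_set N (x^-1 * y) >].

Fact coset_relP : equiv_class_of coset_rel.
Proof.
split=> [x|x y|y x z].
- by apply/asboolP; rewrite mulVg; exact: nsg1.
- by apply/asboolP/asboolP => /nsgV; rewrite invgM invgK.
- move=> /asboolP Nxy /asboolP Nyz; apply/asboolP.
  by have := nsgM Nxy Nyz; rewrite mulgA mulgK.
Qed.

Canonical coset_equiv := EquivRelPack coset_relP.

Definition quotient_group : Type := quotient_topology {eq_quot coset_equiv}.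

HB.instance Definition _ := Topological.on quotient_group.
HB.instance Definition _ := Quotient.on quotient_group.

Definition coset (x : G) : quotient_group := \pi_quotient_group x.

Fact coset_eq (x y : G) : nsg_set N (x^-1 * y) -> coset x = coset y.
Proof. by move=> Nxy; apply/eqmodP/asboolP. Qed.

Fact coset_eqE (x y : G) : coset x = coset y -> nsg_set N (x^-1 * y).
Proof. by move=> /eqmodP/asboolP. Qed.

Fact coset_repr (q : quotient_group) : coset (repr q) = q.
Proof. exact: reprK. Qed.

Definition quotg_mul (p q : quotient_group) := coset (repr p * repr q).
Definition quotg_inv (p : quotient_group) := coset (repr p)^-1.

Fact cosetM x y : coset (x * y) = quotg_mul (coset x) (coset y).
Proof.
apply: coset_eq.
have Nx := coset_eqE (esym (coset_repr (coset x))).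
have Ny := coset_eqE (esym (coset_repr (coset y))).
rewrite invgM -mulgA [x^-1 * _]mulgA.
set x' := repr _ in Nx *; set y' := repr _ in Ny *.
have -> : y^-1 * (x^-1 * x' * y') = y^-1 * (x^-1 * x' * y) * (y^-1 * y').
  by rewrite -!mulgA mulVKg.
exact: nsgM (nsgJ _ Nx) Ny.
Qed.

Fact cosetV x : coset x^-1 = quotg_inv (coset x).
Proof.
apply: coset_eq; rewrite invgK.
have /nsgV Nx := coset_eqE (esym (coset_repr (coset x))).
have := nsgJ x^-1 Nx.
by rewrite invgM !invgK mulgK.
Qed.

Fact quotg_mulA : associative quotg_mul.
Proof.
move=> p q r; rewrite -(coset_repr p) -(coset_repr q) -(coset_repr r).
by rewrite -!cosetM mulgA.
Qed.
Fact quotg_mul1g : left_id (coset 1) quotg_mul.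
Proof. by move=> p; rewrite -(coset_repr p) -cosetM mul1g. Qed.
Fact quotg_mulg1 : right_id (coset 1) quotg_mul.
Proof. by move=> p; rewrite -(coset_repr p) -cosetM mulg1. Qed.
Fact quotg_mulVg : left_inverse (coset 1) quotg_inv quotg_mul.
Proof. by move=> p; rewrite -(coset_repr p) -cosetV -cosetM mulVg. Qed.
Fact quotg_mulgV : right_inverse (coset 1) quotg_inv quotg_mul.
Proof. by move=> p; rewrite -(coset_repr p) -cosetV -cosetM mulgV. Qed.

HB.instance Definition _ := isGroup.Build quotient_group
  quotg_mulA quotg_mul1g quotg_mulg1 quotg_mulVg quotg_mulgV.

Fact coset_continuous : continuous (coset : G -> quotient_group).
Proof. exact: pi_continuous. Qed.

Fact coset_open (U : set G) : open U -> open (coset @` U).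
Proof.
move=> oU; suff : open (coset @^-1` (coset @` U)) by [].
rewrite openE => z [u Uu /coset_eqE Nuz].
set n := u^-1 * z in Nuz; have zE : z * n^-1 = u by rewrite invgM invgK mulVKg.
have cvgz : (w * n^-1) @[w --> z] --> z * n^-1.
  exact: (@cvg_mulg G G (nbhs z) _ idfun (cst n^-1) _ _ cvg_id (cvg_cst _)).
have nU : nbhs (z * n^-1) U by rewrite zE; exact: open_nbhs_nbhs.
apply: (@filterS G (nbhs z) _ _ _ _ (cvgz _ nU)) => w /= Uw; exists (w * n^-1) => //.
by apply: coset_eq; rewrite invgM invgK -mulgA mulVg mulg1.
Qed.

Fact coset_nbhs (x : G) (A : set G) : nbhs x A -> nbhs (coset x) (coset @` A).
Proof.
rewrite nbhsE => -[U [oU Ux] UA].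
apply: (@filterS _ _ _ (coset @` U)); first exact: image_subset.
by apply: open_nbhs_nbhs; split; [exact: coset_open|exists x].
Qed.

Fact quotg_mulg_continuous :
  continuous (fun p : quotient_group * quotient_group => p.1 * p.2).
Proof.
move=> [p q] W /=; rewrite -(coset_repr p) -(coset_repr q).
set x := repr p; set y := repr q.
have -> : coset x * coset y = coset (x * y) by rewrite cosetM.
move=> /coset_continuous /(@mulg_continuous G (x, y)) [[A B] [/= nA nB] AB].
exists (coset @` A, coset @` B).
  by split; apply: coset_nbhs.
move=> [_ _] [/= [a Aa <-] [b Bb <-]].
by have := AB (a, b) (conj Aa Bb); rewrite /= cosetM.
Qed.

Fact quotg_invg_continuous : continuous (fun p : quotient_group => p^-1).
Proof.
move=> p W; rewrite -(coset_repr p); set x := repr p.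
have -> : (coset x)^-1 = coset x^-1 by rewrite cosetV.
move=> /coset_continuous /invg_continuous /coset_nbhs; apply: filterS.
by move=> _ [a Wa <-]; move: Wa; rewrite /= cosetV.
Qed.

HB.instance Definition _ := isTopologicalGroup.Build quotient_group
  quotg_mulg_continuous quotg_invg_continuous.

End QuotientGroup.

(* The scalar field is an abstract [C : numClosedFieldType] so that its
   canonical topology is found by inference; everything is meant for
   [C = R[i]] with [R : realType]. *)

HB.mixin Record CompleteNormedModule_isHilbert (C : numClosedFieldType) V
    of CompleteNormedModule C V := {
  dotp : V -> V -> C;
  dotp_linearl : forall v : V, linear_for *%R (dotp ^~ v);
  dotp_conj : forall u v : V, dotp u v = (dotp v u)^*;
  dotp_norm : forall v : V, dotp v v = `|v| ^+ 2
}.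

#[short(type="hilbertType")]
HB.structure Definition Hilbert (C : numClosedFieldType) :=
  {V of CompleteNormedModule C V & CompleteNormedModule_isHilbert C V}.

Section UnitaryRepresentations.
Variable C : numClosedFieldType.
Implicit Types (G : topGroupType) (H K : hilbertType C).

Definition lin_span H (A : set H) : set H :=
  [set v | exists n (a : 'I_n -> C) (x : 'I_n -> H),
     (forall i, A (x i)) /\ v = \sum_i a i *: x i].

Definition total H (A : set H) : Prop := closure (lin_span A) = setT.

Record unitary_rep G H := UnitaryRep {
  rep_fun :> G -> {linear H -> H};
  rep_fun1 : forall v, rep_fun 1%g v = v;
  rep_funM : forall x y v, rep_fun (x * y)%g v = rep_fun x (rep_fun y v);
  rep_fun_dotp : forall x u v, dotp (rep_fun x u) (rep_fun x v) = dotp u v;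
  rep_fun_continuous : forall v, continuous (fun x => rep_fun x v)
}.

Definition coef G H (pi : unitary_rep G H) (xi : H) : G -> C :=
  fun x => dotp (pi x xi) xi.

Definition positive_definite G (u : G -> C) : Prop :=
  forall n (c : 'I_n -> C) (s : 'I_n -> G),
    0 <= \sum_i \sum_j c i * (c j)^* * u ((s j)^-1 * s i)%g.

Definition normalized_pd G (u : G -> C) : Prop :=
  [/\ continuous u, positive_definite u & u 1%g = 1].

(* GNS representations, Hilbert direct sums and Hilbert tensor products are
   described by the properties that determine them up to unitary equivalence. *)
Definition is_GNS G H (u : G -> C) (pi : unitary_rep G H) : Prop :=
  exists xi : H, coef pi xi = u /\ total (range (fun x => pi x xi)).

Definition is_direct_sum G (I : Type) (K_ : I -> hilbertType C)
    (pi_ : forall i, unitary_rep G (K_ i)) H (pi : unitary_rep G H) : Prop :=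
  exists iota : forall i, {linear K_ i -> H},
    [/\ forall i v w, dotp (iota i v) (iota i w) = dotp v w,
        forall i j v w, i <> j -> dotp (iota i v) (iota j w) = 0,
        total (\bigcup_i range (iota i)) &
        forall i x v, pi x (iota i v) = iota i (pi_ i x v)].

Definition is_infinite_ampliation G K (pi : unitary_rep G K) H
    (sigma : unitary_rep G H) : Prop :=
  is_direct_sum (fun _ : nat => pi) sigma.

Definition is_universal_rep G H (varpi : unitary_rep G H) : Prop :=
  exists (K_ L_ : {u : G -> C | normalized_pd u} -> hilbertType C)
         (pi_ : forall u, unitary_rep G (K_ u))
         (sigma_ : forall u, unitary_rep G (L_ u)),
    [/\ forall u, is_GNS (sval u) (pi_ u),
        forall u, is_infinite_ampliation (pi_ u) (sigma_ u) &
        is_direct_sum sigma_ varpi].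

Definition is_hilbert_tensor H1 H2 K (t : {bilinear H1 -> H2 -> K}) : Prop :=
  (forall x x' y y', dotp (t x y) (t x' y') = dotp x x' * dotp y y') /\
  total [set z | exists x y, z = t x y].

(* With [t] the Hilbert tensor product of [H] with itself, [rho] is
   [(s, t) |-> pi s (x) pi t]. *)
Definition is_kronecker_rep G H (pi : unitary_rep G H) K
    (t : {bilinear H -> H -> K}) (rho : unitary_rep (G * G)%type K) : Prop :=
  forall p x y, rho p (t x y) = t (pi p.1 x) (pi p.2 y).

Definition cone_gen T (S : set (T -> C)) : set (T -> C) :=
  [set f | exists n (a : 'I_n -> C) (g : 'I_n -> T -> C),
     (forall i, 0 <= a i /\ S (g i)) /\ f = fun x => \sum_i a i * g i x].

(* Unitarily equivalent models of the universal representation and of its tensor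
   square have the same coefficient functions, so any choice of models gives the
   same set. The topology of [{family compact, _ -> _}] is that of uniform
   convergence on compact sets. *)
Definition Pmin G : set (G * G -> C) :=
  [set f | exists H (varpi : unitary_rep G H) K (t : {bilinear H -> H -> K})
             (rho : unitary_rep (G * G)%type K),
     [/\ is_universal_rep varpi, is_hilbert_tensor t,
         is_kronecker_rep varpi t rho &
         closure (cone_gen (range (coef rho)) : set {family compact, G * G -> C})
           f]].

Definition traces G : set (G -> C) :=
  [set u | normalized_pd u /\ forall s t, u (s * t)%g = u (t * s)%g].

Definition amenable_traces G : set (G -> C) :=
  [set u | traces u /\ Pmin (fun p : G * G => u (p.1 * p.2^-1)%g)].

Definition NamTr G : set G :=
  \bigcap_(u in @amenable_traces G) (u @^-1` [set 1]).

(* [Q] and [e] form a Kazhdan pair. *)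
Definition property_T G : Prop :=
  exists Q : set G, compact Q /\
  exists2 e : C, 0 < e &
    forall H (pi : unitary_rep G H),
      (exists xi : H, xi <> 0 /\ forall x, Q x -> `|pi x xi - xi| < e * `|xi|) ->
      exists eta : H, eta <> 0 /\ forall x, pi x eta = eta.

Definition is_fd_unitary_rep G n (rho : G -> 'M[C]_n) : Prop :=
  [/\ continuous rho, forall x, rho x \is unitarymx &
      forall x y, rho (x * y)%g = rho x *m rho y].

Definition MAP G : Prop :=
  forall x y : G, x <> y ->
    exists n (rho : G -> 'M[C]_n), is_fd_unitary_rep rho /\ rho x <> rho y.

Definition NMAP G : set G :=
  \bigcap_(N in [set N : normalSubgroup G |
                  closed (N : set G) /\ MAP (quotient_group N)]) (N : set G).

End UnitaryRepresentations.

Arguments Pmin C G : clear implicits.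
Arguments traces C G : clear implicits.
Arguments amenable_traces C G : clear implicits.
Arguments NamTr C G : clear implicits.
Arguments property_T C G : clear implicits.
Arguments MAP C G : clear implicits.
Arguments NMAP C G : clear implicits.

(* Main.v *)
(* If [x] lies outside a closed normal subgroup [N] with [G/N] maximally almost
   periodic, a finite-dimensional unitary representation separates [x] from [1].
   Restricted to a cyclic subspace it embeds, like its conjugate, in the universal
   representation, so that its normalised character [u] gives
   [u (s t^-1) = <(varpi s (x) varpi t) kappa, kappa>] for some [kappa]; thus [u] is
   an amenable trace with [u x <> 1].

   Conversely, let [u] be an amenable trace. Since [u (s s^-1) = 1], approximating
   [u (s t^-1)] by coefficients of [varpi x varpi] produces vectors that are almost
   invariant under the diagonal of [G x G], and property (T) puts them close to
   diagonally invariant vectors. Such a vector is a Hilbert-Schmidt operator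
   intertwining [varpi] with its conjugate, so it is carried by finite-dimensional
   subrepresentations, on which the von Neumann kernel acts trivially. *)
Require Import Defs.
From HB Require Import structures.
From mathcomp Require Import all_boot all_order all_algebra.
From mathcomp Require Import sesquilinear spectral complex.
From mathcomp Require Import all_classical all_reals topology normedtype.
From mathcomp Require Import sequences ring lra.

Set Implicit Arguments.
Unset Strict Implicit.
Unset Printing Implicit Defensive.

Import Order.TTheory GRing.Theory Num.Theory.
Import numFieldNormedType.Exports.
Import Defs.

Local Open Scope classical_set_scope.
Local Open Scope ring_scope.

(** * Scalars and semi-inner products *)

(** An approximant of [u (s t^-1)] is a finite sum of coefficients with no bound on the number of
    summands, and a single summand may be moved a lot relative to its own norm, so property (T)
    cannot be applied to one summand at a time. All summands are therefore stored in one vector of a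
    representation of [G] on [n] copies of the orthogonal complement of the diagonally invariant
    vectors. That representation has no nonzero invariant vector, so the Kazhdan pair bounds the
    norm of this one vector independently of [n]. The value [u s] is read off at [(s, 1)]: the
    invariant parts of the summands are fixed by [(s, 1)], and the rest contributes at most twice
    the squared norm just bounded.

    Since [Pmin] quantifies over models, the inclusion of [NamTr] in [NMAP] has to produce some. GNS
    spaces, direct sums, tensor squares and the [n] copies above all come from one construction, the
    Hilbert space of a positive definite kernel that is invariant under a group action. *)

Section ComplexScalars.
Variable R : realType.
Notation C := (R[i] : numClosedFieldType).
Implicit Types (x y z : C) (e : R).

Local Notation toC := (fun e : R => (e%:C)%C : C).

Lemma ReIm_normE z : `|z| = ((Num.sqrt (complex.Re z ^+ 2 + complex.Im z ^+ 2))%:C)%C :> C.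
Proof. exact: normc_def. Qed.

Lemma norm_Re_le z : ((`|complex.Re z|)%:C)%C <= `|z| :> C.
Proof. exact: normc_ge_Re. Qed.

Lemma norm_Im_le z : ((`|complex.Im z|)%:C)%C <= `|z| :> C.
Proof.
rewrite ReIm_normE lecR -sqrtr_sqr ler_wsqrtr// lerDr sqr_ge0 //.
Qed.

Lemma norm_ReIm_le z :
  `|z| <= ((`|complex.Re z| + `|complex.Im z|)%:C)%C :> C.
Proof.
case: z => a b; rewrite ReIm_normE lecR /=.
rewrite -[leRHS]ger0_norm ?addr_ge0// -sqrtr_sqr ler_wsqrtr//.
by rewrite sqrrD !real_normK ?num_real// -addrA lerD2l lerDr mulrn_wge0 // mulr_ge0.
Qed.

Lemma posC_real (x : C) : 0 < x -> exists2 e : R, 0 < e & x = toC e.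
Proof.
move=> x0; exists (complex.Re x); last by rewrite RRe_real // gtr0_real.
by move: x0; rewrite ltcE /= => /andP[].
Qed.

Lemma cvg_Re (T : Type) (F : set_system T) {FF : Filter F} (f : T -> C) (l : C) :
  f @ F --> l -> complex.Re (f x) @[x --> F] --> complex.Re l.
Proof.
move=> fl; apply/cvgrPdist_lt => e e0.
have e0' : 0 < toC e by rewrite ltcR.
move/cvgrPdist_lt : fl => /(_ _ e0'); apply: filterS => x.
by move=> /(le_lt_trans (norm_Re_le _)); rewrite ltcR; case: (f x) l => ? ? [].
Qed.

Lemma cvg_Im (T : Type) (F : set_system T) {FF : Filter F} (f : T -> C) (l : C) :
  f @ F --> l -> complex.Im (f x) @[x --> F] --> complex.Im l.
Proof.
move=> fl; apply/cvgrPdist_lt => e e0.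
have e0' : 0 < toC e by rewrite ltcR.
move/cvgrPdist_lt : fl => /(_ _ e0'); apply: filterS => x.
by move=> /(le_lt_trans (norm_Im_le _)); rewrite ltcR; case: (f x) l => ? ? [].
Qed.

Lemma cvg_ReIm (T : Type) (F : set_system T) {FF : Filter F} (f : T -> C) (a b : R) :
  complex.Re (f x) @[x --> F] --> a -> complex.Im (f x) @[x --> F] --> b ->
  f @ F --> (Complex a b : C).
Proof.
move=> fa fb; apply/cvgrPdist_lt => _ /posC_real[e e0 ->].
have e2 : 0 < e / 2 by rewrite divr_gt0.
move/cvgrPdist_lt : fa => /(_ _ e2) fa.
move/cvgrPdist_lt : fb => /(_ _ e2) fb.
apply: filterS2 fa fb => x xa xb.
apply: (le_lt_trans (norm_ReIm_le _)); rewrite ltcR [ltRHS]splitr.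
by case: (f x) xa xb => u v /=; exact: ltrD.
Qed.

Lemma cauchy_cvgC (F : set_system C) : ProperFilter F ->
  cauchy F -> exists l : C, F --> l.
Proof.
move=> FF /cauchyP Fc.
have key (g : C -> R) : (forall x y, (`|g x - g y|%:C)%C <= `|x - y| :> C) ->
    cvg (g @ F).
  move=> glip; apply: cauchy_cvg; apply/cauchyP => e e0.
  have e0' : 0 < toC e by rewrite ltcR.
  have [x Fx] := Fc _ e0'; exists (g x).
  apply: (@filterS _ F _ _ _ _ Fx) => y; rewrite -!ball_normE /ball_ /= => xy.
  by have := le_lt_trans (glip x y) xy; rewrite ltcR.
have /cvg_ex[a ha] : cvg (@complex.Re R @ F).
  by apply: key => x y; have := norm_Re_le (x - y); case: x y => ? ? [].
have /cvg_ex[b hb] : cvg (@complex.Im R @ F).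
  by apply: key => x y; have := norm_Im_le (x - y); case: x y => ? ? [].
exists (Complex a b : C).
exact: (@cvg_ReIm C F _ id a b ha hb).
Qed.

Lemma cauchy_seqC (s : nat -> C) :
  (forall e : C, 0 < e -> exists N, forall m n, (N <= m)%N -> (N <= n)%N -> `|s m - s n| < e) ->
  exists l : C, s n @[n --> \oo] --> l.
Proof.
move=> sc; apply: cauchy_cvgC; apply/cauchyP => e e0.
have [N HN] := sc _ e0; exists (s N); exists N => // n /= Nn.
by rewrite -ball_normE /ball_ /=; exact: HN.
Qed.

(** The image of an ultrafilter is an ultrafilter, so compactness of [[-M, M]] makes the real and
    the imaginary part converge. *)
Lemma ultra_bounded_cvg (T : Type) (F : set_system T) (f : T -> C) (M : C) :
  UltraFilter F -> F [set x | `|f x| <= M] -> exists l : C, f @ F --> l.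
Proof.
move=> FU FM.
have key (g : C -> R) : (forall x, (`|g x|%:C)%C <= `|x| :> C) -> cvg (g (f x) @[x --> F]).
  move=> glip.
  have := @segment_compact R (- complex.Re M) (complex.Re M).
  rewrite compact_ultra => /(_ [set A | F ((g \o f) @^-1` A)]).
  case.
  - have [Fp Fm] := FU; split.
      split; first by rewrite /= preimage_set0; exact: filter_not_empty.
      split => /=; first by rewrite preimage_setT; exact: filterT.
      + by move=> P Q /= FP FQ; rewrite preimage_setI; exact: filterI.
      + by move=> P Q PQ; apply: filterS => x; exact: PQ.
    move=> G GP FG; apply/seteqP; split => A GA; last exact: FG.
    have [//|nA] := in_ultra_setVsetC ((g \o f) @^-1` A) FU.
    exfalso; have : G (~` A) by exact: FG.
    by move=> /(filterI GA); rewrite setICr; exact: filter_not_empty.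
  - apply: (@filterS _ F _ _ _ _ FM) => x /= fM.
    have := le_trans (glip (f x)) fM; rewrite lecE /= => /andP[_].
    by rewrite in_itv /= ler_norml.
  - by move=> l [_ Fl]; apply/cvg_ex; exists l => A /Fl.
have /cvg_ex[a ha] := key _ norm_Re_le.
have /cvg_ex[b hb] := key _ norm_Im_le.
by exists (Complex a b : C); apply: cvg_ReIm.
Qed.

(** Nonnegativity in [C] includes being real, so the imaginary part of the limit must be shown to
    vanish as well. *)
Lemma cvg_ge0C (T : Type) (F : set_system T) {FF : ProperFilter F} (f : T -> C) (l : C) :
  f @ F --> l -> (\forall x \near F, 0 <= f x) -> 0 <= l.
Proof.
move=> fl f0; have lr : complex.Re (f x) @[x --> F] --> complex.Re l by exact: cvg_Re.
have li : complex.Im (f x) @[x --> F] --> complex.Im l by exact: cvg_Im.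
rewrite lecE /=; apply/andP; split.
  have h : complex.Im (f x) @[x --> F] --> (0 : R).
    apply: cvg_near_cst; apply: (@filterS _ F _ _ _ _ f0) => x.
    by rewrite lecE /= => /andP[/eqP -> _].
  by rewrite (cvg_unique (@norm_hausdorff _ R) li h).
have <- := cvg_lim (@norm_hausdorff _ R) lr.
apply: limr_ge; first by apply/cvg_ex; eexists; exact: lr.
by apply: (@filterS _ F _ _ _ _ f0) => x; rewrite lecE /= => /andP[].
Qed.

End ComplexScalars.

Section HalfBounds.
Variables (K : numFieldType) (V : normedZmodType K).

Lemma normD_lt_half (x y : V) (e : K) : `|x| < e / 2 -> `|y| < e / 2 -> `|x + y| < e.
Proof.
by move=> xe ye; rewrite [ltRHS]splitr; apply: le_lt_trans (ler_normD _ _) (ltrD xe ye).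
Qed.

Lemma normB_lt_half (x y : V) (e : K) : `|x| < e / 2 -> `|y| < e / 2 -> `|x - y| < e.
Proof. by move=> xe ye; apply: normD_lt_half; rewrite ?normrN. Qed.

End HalfBounds.

Section SemiInner.
Variable C : numClosedFieldType.

Lemma cvg_conjC (T : Type) (F : set_system T) {FF : Filter F} (f : T -> C) (l : C) :
  f @ F --> l -> (f x)^* @[x --> F] --> l^*.
Proof.
move=> fl; apply/cvgrPdist_lt => e e0.
move/cvgrPdist_lt : fl => /(_ _ e0); apply: filterS => x.
by rewrite -rmorphB /= norm_conjC.
Qed.

(** Stated for the values of a semi-definite form on two vectors, so that it serves modules as well
    as lists of formal sums, which form no module. *)
Lemma herm_CauchySchwarz (A D B : C) : 0 <= A -> 0 <= D ->
  (forall z w, 0 <= z * z^* * A + z * w^* * B + (z * w^* * B)^* + w * w^* * D) ->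
  `|B| ^+ 2 <= A * D.
Proof.
move=> A0 D0 H; have Ar := CrealP (ger0_real A0); have Dr := CrealP (ger0_real D0).
have [D00|Dn0] := eqVneq D 0.
  have [->|Bn0] := eqVneq B 0; first by rewrite normr0 expr0n /= mulr_ge0.
  have B2 : `|B| ^+ 2 != 0 by rewrite sqrf_eq0 normr_eq0.
  (* If [D = 0] and [B != 0], the pair [z = 1], [w = - t * B] gives the form the negative value
     [- (A + 2)]. *)
  have [t tr tB] : exists2 t : C, t^* = t & t * `|B| ^+ 2 = A + 1.
    exists ((A + 1) / `|B| ^+ 2); last by rewrite divfK.
    by apply/CrealP/ger0_real; rewrite divr_ge0 ?exprn_ge0 ?addr_ge0.
  have := H 1 (- t * B).
  have -> : 1 * 1^* * A + 1 * (- t * B)^* * B + (1 * (- t * B)^* * B)^* +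
      (- t * B) * (- t * B)^* * D = - (A + 1 + 1).
    rewrite D00 !(rmorphM, rmorphN, rmorph1) /= !conjCK tr ?rmorph1.
    by move: tB; rewrite normCK => tB; ring: tB.
  rewrite oppr_ge0 => /(lt_le_trans _) => /(_ 0).
  by rewrite ltxx => h; exfalso; have : false by apply: h; rewrite ltr_wpDl ?addr_ge0.
have Dp : 0 < D by rewrite lt_neqAle eq_sym Dn0.
have := H D (- B).
have -> : D * D^* * A + D * (- B)^* * B + (D * (- B)^* * B)^* +
    - B * (- B)^* * D = D * (A * D - `|B| ^+ 2).
  by rewrite !(rmorphM, rmorphN) /= !conjCK Dr normCK; ring.
by rewrite pmulr_rge0 // subr_ge0.
Qed.

Variables (V : lmodType C) (d : V -> V -> C).
Hypothesis dDl : forall u v w, d (u + v) w = d u w + d v w.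
Hypothesis dZl : forall z u w, d (z *: u) w = z * d u w.
Hypothesis dC : forall u v, d u v = (d v u)^*.
Hypothesis d_ge0 : forall u, 0 <= d u u.

Lemma inner_DrZr z w u v x : d u (z *: v + w *: x) = z^* * d u v + w^* * d u x.
Proof. by rewrite dC dDl !dZl rmorphD !rmorphM /= -!dC. Qed.

Lemma inner_CS u v : `|d u v| <= sqrtC (d u u) * sqrtC (d v v).
Proof.
rewrite -(@ler_pXn2r _ 2 isT) ?nnegrE ?mulr_ge0 ?sqrtC_ge0 //.
rewrite exprMn !sqrtCK; apply: herm_CauchySchwarz => // z w.
have := d_ge0 (z *: u + w *: v).
rewrite dDl !dZl !inner_DrZr (dC v u) !rmorphM /= conjCK.
by congr (0 <= _); ring.
Qed.

Lemma inner_triangle u v : sqrtC (d (u + v) (u + v)) <= sqrtC (d u u) + sqrtC (d v v).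
Proof.
rewrite -(@ler_pXn2r _ 2 isT) ?nnegrE ?addr_ge0 ?sqrtC_ge0 //.
rewrite sqrrD !sqrtCK.
have -> : d (u + v) (u + v) = d u u + 'Re (d u v) *+ 2 + d v v.
  have /(_ u) E : forall w, d w (u + v) = d w u + d w v.
    by move=> w; rewrite -[u]scale1r -[v]scale1r inner_DrZr rmorph1 !scale1r !mul1r.
  have /(_ v) E' : forall w, d w (u + v) = d w u + d w v.
    by move=> w; rewrite -[u]scale1r -[v]scale1r inner_DrZr rmorph1 !scale1r !mul1r.
  by rewrite dDl E E' (dC v u) ReE; by field.
rewrite lerD2r lerD2l lerMn2r /=; apply: le_trans (inner_CS u v).
exact: (leif_Re_Creal _).1.
Qed.

Lemma inner_normZ z u : sqrtC (d (z *: u) (z *: u)) = `|z| * sqrtC (d u u).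
Proof.
have -> : d (z *: u) (z *: u) = `|z| ^+ 2 * d u u.
  by rewrite dZl dC dZl rmorphM /= -dC mulrA -normCK.
by rewrite rootCMl ?exprn_ge0 // sqrCK.
Qed.

End SemiInner.

(** * The Hilbert space of a positive definite kernel *)

Record pd_kernel (C : numClosedFieldType) (X : Type) := PdKernel {
  kfun :> X -> X -> C;
  kfunC : forall x y, kfun y x = (kfun x y)^*;
  kfun_ge0 : forall a : seq (C * X),
    0 <= \sum_(p <- a) \sum_(q <- a) p.1 * q.1^* * kfun p.2 q.2
}.

Section FormalSums.
Variables (C : numClosedFieldType) (X : Type) (K : pd_kernel C X).
Implicit Types (a b c : seq (C * X)).

(** Formal combinations of points are unreduced lists with concatenation as addition; they need no
    normal form because only values of [kform] matter. *)
Definition kform a b : C := \sum_(p <- a) \sum_(q <- b) p.1 * q.1^* * K p.2 q.2.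
Definition lscale (z : C) a : seq (C * X) := [seq (z * p.1, p.2) | p <- a].
Definition lsub a b := a ++ lscale (-1) b.
Definition kev a (x : X) : C := kform a [:: (1, x)].
Definition knorm a : C := sqrtC (kform a a).

Lemma kformC a b : kform b a = (kform a b)^*.
Proof.
rewrite /kform exchange_big /= rmorph_sum /=; apply: eq_bigr => p _.
rewrite rmorph_sum /=; apply: eq_bigr => q _.
by rewrite !rmorphM /= conjCK kfunC -mulrA mulrCA mulrA.
Qed.

Lemma kform_catl a b c : kform (a ++ b) c = kform a c + kform b c.
Proof. by rewrite /kform big_cat. Qed.

Lemma kform_scalel z a b : kform (lscale z a) b = z * kform a b.
Proof.
rewrite /kform big_map mulr_sumr; apply: eq_bigr => p _ /=.
by rewrite mulr_sumr; apply: eq_bigr => q _; rewrite !mulrA.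
Qed.

Lemma kform_catr a b c : kform c (a ++ b) = kform c a + kform c b.
Proof. by rewrite kformC kform_catl rmorphD /= -!kformC. Qed.

Lemma kform_scaler z a b : kform b (lscale z a) = z^* * kform b a.
Proof. by rewrite kformC kform_scalel rmorphM /= -kformC. Qed.

Lemma kform_subl a b c : kform (lsub a b) c = kform a c - kform b c.
Proof. by rewrite kform_catl kform_scalel mulN1r. Qed.

Lemma kform_subr a b c : kform c (lsub a b) = kform c a - kform c b.
Proof. by rewrite kform_catr kform_scaler rmorphN rmorph1 mulN1r. Qed.

Lemma kform_ge0 a : 0 <= kform a a.
Proof. exact: kfun_ge0. Qed.

Lemma kform_CS a b : `|kform a b| <= knorm a * knorm b.
Proof.
rewrite -(@ler_pXn2r _ 2 isT) ?nnegrE ?mulr_ge0 ?sqrtC_ge0 ?kform_ge0 //.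
rewrite exprMn !sqrtCK; apply: herm_CauchySchwarz => [||z w]; try exact: kform_ge0.
have := kform_ge0 (lscale z a ++ lscale w b).
rewrite kform_catl !kform_catr !kform_scalel !kform_scaler (kformC a b) !rmorphM /= conjCK.
by congr (0 <= _); ring.
Qed.

Lemma knorm_ge0 a : 0 <= knorm a.
Proof. by rewrite sqrtC_ge0 kform_ge0. Qed.

Lemma knormE a : knorm a ^+ 2 = kform a a.
Proof. by rewrite sqrtCK. Qed.

Lemma knorm_cat a b : knorm (a ++ b) <= knorm a + knorm b.
Proof.
rewrite -(@ler_pXn2r _ 2 isT) ?nnegrE ?addr_ge0 ?knorm_ge0 //.
rewrite knormE sqrrD !knormE.
have -> : kform (a ++ b) (a ++ b) = kform a a + 'Re (kform a b) *+ 2 + kform b b.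
  rewrite kform_catl !kform_catr (kformC a b) ReE; by field.
rewrite lerD2r lerD2l lerMn2r /=; apply: le_trans (kform_CS a b).
exact: (leif_Re_Creal _).1.
Qed.

Lemma knorm_scale z a : knorm (lscale z a) = `|z| * knorm a.
Proof.
rewrite /knorm kform_scalel kform_scaler mulrA -normCK.
by rewrite rootCMl ?exprn_ge0 // sqrCK.
Qed.

Lemma knorm_le_sub a b : knorm a <= knorm b + knorm (lsub a b).
Proof.
suff -> : knorm a = knorm (b ++ lsub a b) by exact: knorm_cat.
by congr sqrtC; rewrite kform_catl !(kform_catr b) !kform_subl !kform_subr; ring.
Qed.

End FormalSums.

Section CauchySums.
Variables (R : realType) (X : Type).
Notation C := (R[i] : numClosedFieldType).
Variable K : pd_kernel C X.
Implicit Types (a b c : nat -> seq (C * X)) (f g : X -> C).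

Lemma kform_lt (l l' : seq (C * X)) (e M : C) : 0 < M ->
  knorm K l < e / M -> knorm K l' <= M -> `|kform K l l'| < e.
Proof.
move=> M0 le lM; apply: (le_lt_trans (kform_CS _ _ _)).
apply: le_lt_trans (_ : knorm K l * M < _); last by rewrite -ltr_pdivlMr.
by rewrite ler_wpM2l ?knorm_ge0.
Qed.

Lemma kform_ltr (l l' : seq (C * X)) (e M : C) : 0 < M ->
  knorm K l < e / M -> knorm K l' <= M -> `|kform K l' l| < e.
Proof. by move=> M0 le lM; rewrite kformC norm_conjC (kform_lt M0). Qed.

Definition kcauchy a := forall e : C, 0 < e -> exists N, forall m n,
  (N <= m)%N -> (N <= n)%N -> knorm K (lsub (a m) (a n)) < e.

Lemma kcauchy_bounded a : kcauchy a ->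
  exists2 M : C, 0 < M & \forall n \near \oo, knorm K (a n) <= M.
Proof.
move=> /(_ _ (@ltr01 C))[N aN]; exists (knorm K (a N) + 1).
  by rewrite ltr_wpDl ?knorm_ge0.
exists N => // n /= Nn; apply: (le_trans (knorm_le_sub K (a n) (a N))).
by rewrite lerD2l ltW // aN.
Qed.

Lemma kcauchy_cat a b : kcauchy a -> kcauchy b -> kcauchy (fun n => a n ++ b n).
Proof.
move=> ac bc e e0; have e2 : 0 < e / 2 by rewrite divr_gt0.
have [N aN] := ac _ e2; have [M bM] := bc _ e2; exists (maxn N M) => m n.
rewrite !geq_max => /andP[Nm Mm] /andP[Nn Mn].
have -> : knorm K (lsub (a m ++ b m) (a n ++ b n)) =
          knorm K (lsub (a m) (a n) ++ lsub (b m) (b n)).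
  by congr sqrtC; rewrite !(kform_catl, kform_catr, kform_scalel, kform_scaler); ring.
by rewrite [ltRHS]splitr; apply: le_lt_trans (knorm_cat _ _ _) (ltrD (aN _ _ _ _) (bM _ _ _ _)).
Qed.

Lemma kcauchy_scale z a : kcauchy a -> kcauchy (fun n => lscale z (a n)).
Proof.
move=> ac e e0; have z0 : 0 < `|z| + 1 by rewrite ltr_wpDl.
have [N aN] := ac _ (divr_gt0 e0 z0); exists N => m n Nm Nn.
have -> : knorm K (lsub (lscale z (a m)) (lscale z (a n))) = knorm K (lscale z (lsub (a m) (a n))).
  congr sqrtC; rewrite !(kform_catl, kform_catr, kform_scalel, kform_scaler).
  by rewrite rmorphN rmorph1; ring.
rewrite knorm_scale; apply: le_lt_trans (_ : (`|z| + 1) * knorm K (lsub (a m) (a n)) < e).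
  by rewrite ler_wpM2r ?knorm_ge0 // lerDl.
by rewrite mulrC -ltr_pdivlMr // aN.
Qed.

Lemma kcauchy_cst l : kcauchy (fun _ => l).
Proof.
move=> e e0; exists 0%N => _ _ _ _; suff -> : knorm K (lsub l l) = 0 by [].
by rewrite /knorm kform_subl !kform_subr !subrr rootC0.
Qed.

Lemma kcauchy_form a b : kcauchy a -> kcauchy b ->
  exists l : C, kform K (a n) (b n) @[n --> \oo] --> l.
Proof.
move=> ac bc; apply: cauchy_seqC => e e0.
have [Ma Ma0 [N1 _ aM]] := kcauchy_bounded ac.
have [Mb Mb0 [N2 _ bM]] := kcauchy_bounded bc.
have [N3 aN] := ac _ (divr_gt0 (divr_gt0 e0 (ltr0n C 2)) Mb0).
have [N4 bN] := bc _ (divr_gt0 (divr_gt0 e0 (ltr0n C 2)) Ma0).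
exists (maxn (maxn N1 N2) (maxn N3 N4)) => m n; rewrite !geq_max.
move=> /andP[/andP[m1 m2] /andP[m3 m4]] /andP[/andP[n1 n2] /andP[n3 n4]].
have -> : kform K (a m) (b m) - kform K (a n) (b n) =
   kform K (lsub (a m) (a n)) (b m) + kform K (a n) (lsub (b m) (b n)).
  by rewrite kform_subl kform_subr; ring.
apply: (le_lt_trans (ler_normD _ _)); rewrite [ltRHS]splitr; apply: ltrD.
  by apply: (kform_lt Mb0); [exact: aN | exact: bM].
by apply: (kform_ltr Ma0); [exact: bN | exact: aM].
Qed.

Definition krep f a := kcauchy a /\ forall x, kev K (a n) x @[n --> \oo] --> f x.

Lemma kev_cvg_form a (l : seq (C * X)) (f : X -> C) :
  (forall x, kev K (a n) x @[n --> \oo] --> f x) ->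
  kform K (a n) l @[n --> \oo] --> \sum_(q <- l) q.1^* * f q.2.
Proof.
move=> af.
have -> : (fun n => kform K (a n) l) = (fun n => \sum_(q <- l) q.1^* * kev K (a n) q.2).
  apply/funext => n; rewrite /kform exchange_big /=; apply: eq_bigr => q _.
  rewrite /kev /kform mulr_sumr; apply: eq_bigr => p _.
  by rewrite big_seq1 /= rmorph1 mulr1 mulrA [q.1^* * _]mulrC.
elim: l => [|q l IH].
  rewrite big_nil; under eq_fun do rewrite big_nil; exact: cvg_cst.
rewrite big_cons; under eq_fun do rewrite big_cons.
apply: cvgD; last exact: IH.
by apply: cvgM; [exact: cvg_cst | exact: af].
Qed.

(** This makes the limit function determine the class of a Cauchy sequence. In [<a n, a n> = <a n, a
    N> + <a n, a n - a N>] the first term tends to 0 because [a N] is one finite sum; the second is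
    small by the Cauchy property. *)
Lemma krep0 a : krep (fun=> 0) a -> forall e : C, 0 < e -> \forall n \near \oo, knorm K (a n) < e.
Proof.
move=> [ac a0] e e0.
have [M M0 [N1 _ aM]] := kcauchy_bounded ac.
have e2 : 0 < e ^+ 2 / 2 by rewrite divr_gt0 // exprn_gt0.
have [N2 aN] := ac _ (divr_gt0 e2 M0).
pose N := maxn N1 N2.
have := kev_cvg_form (l := a N) a0; rewrite big1 => [|q _]; last by rewrite mulr0.
move/cvgrPdist_lt => /(_ _ e2)[N3 _ H].
exists (maxn N N3) => // n; rewrite /= !geq_max -andbA => /and3P[n1 n2 n3].
rewrite -(@ltr_pXn2r _ 2 isT) ?nnegrE ?knorm_ge0 // ?ltW //.
rewrite -[ltLHS]ger0_norm ?exprn_ge0 ?knorm_ge0 // knormE.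
have -> : kform K (a n) (a n) = kform K (a n) (a N) + kform K (a n) (lsub (a n) (a N)).
  by rewrite kform_subr; ring.
apply: (le_lt_trans (ler_normD _ _)); rewrite [ltRHS]splitr; apply: ltrD.
  by have := H n n3; rewrite /= sub0r normrN.
by apply: (kform_ltr M0); [rewrite aN // leq_maxr | exact: aM].
Qed.

Lemma krepD f g a b : krep f a -> krep g b -> krep (f + g) (fun n => a n ++ b n).
Proof.
move=> [ac af] [bc bg]; split=> [|x]; first exact: kcauchy_cat.
rewrite /kev; under eq_fun do rewrite kform_catl; apply: cvgD; [exact: af | exact: bg].
Qed.

Lemma krepZ z f a : krep f a -> krep (z *: f) (fun n => lscale z (a n)).
Proof.
move=> [ac af]; split=> [|x]; first exact: kcauchy_scale.
rewrite /kev; under eq_fun do rewrite kform_scalel; apply: cvgM; [exact: cvg_cst | exact: af].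
Qed.

Lemma krepB f g a b : krep f a -> krep g b -> krep (f - g) (fun n => lsub (a n) (b n)).
Proof.
move=> fa gb; have -> : f - g = f + (-1) *: g by rewrite scaleN1r.
exact: (krepD fa (krepZ (-1) gb)).
Qed.

Lemma krep_cst (l : seq (C * X)) : krep (kev K l) (fun=> l).
Proof. by split=> [|x]; [exact: kcauchy_cst | exact: cvg_cst]. Qed.

(** Two representatives of one function differ by a sequence representing 0, which [krep0] makes
    small; so the inner product below does not depend on the chosen representatives. *)
Lemma krep_form_eq f g a b a' b' (l : C) : krep f a -> krep f a' -> krep g b -> krep g b' ->
  kform K (a n) (b n) @[n --> \oo] --> l -> kform K (a' n) (b' n) @[n --> \oo] --> l.
Proof.
move=> fa fa' gb gb' /cvgrPdist_lt abl; apply/cvgrPdist_lt => e e0.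
have e3 : 0 < e / 2 / 2 by rewrite !divr_gt0.
have e2 : 0 < e / 2 by rewrite divr_gt0.
have [Ma Ma0 aM] := kcauchy_bounded fa'.1.
have [Mb Mb0 bM] := kcauchy_bounded gb.1.
have da := krepB fa' fa; have db := krepB gb' gb; rewrite !subrr in da db.
have {}da := krep0 da (divr_gt0 e3 Mb0); have {}db := krep0 db (divr_gt0 e3 Ma0).
have {}abl := abl _ e2; near=> n.
have -> : l - kform K (a' n) (b' n) = (l - kform K (a n) (b n)) -
  (kform K (lsub (a' n) (a n)) (b n) + kform K (a' n) (lsub (b' n) (b n))).
  by rewrite kform_subl kform_subr; ring.
apply: (le_lt_trans (ler_normB _ _)); rewrite [ltRHS]splitr; apply: ltrD; first by near: n.
apply: (le_lt_trans (ler_normD _ _)); rewrite [ltRHS]splitr; apply: ltrD.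
  by apply: (kform_lt Mb0); near: n.
by apply: (kform_ltr Ma0); near: n.
Unshelve. all: by end_near.
Qed.

End CauchySums.

Section RKHS.
Variables (R : realType) (X : Type).
Notation C := (R[i] : numClosedFieldType).
Variable K : pd_kernel C X.
(* The completion is realised inside [X -> C], a limit of formal sums [a n] being
   identified with [x |-> lim <a n, delta_x>]; a group acting on [X] then acts on it
   by precomposition. *)
Definition rkhs_mem : {pred (X -> C)} := fun f => `[< exists a, krep K f a >].

Fact rkhs_submod : submod_closed rkhs_mem.
Proof.
split.
  apply/asboolP; exists (fun=> [::]); split=> [|x]; first exact: kcauchy_cst.
  by rewrite /kev /kform; under eq_fun do rewrite big_nil; exact: cvg_cst.
move=> z f g /asboolP[a fa] /asboolP[b gb]; apply/asboolP.
by eexists; apply: krepD gb; exact: krepZ fa.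
Qed.

HB.instance Definition _ := GRing.isSubmodClosed.Build _ _ rkhs_mem rkhs_submod.

Record rkhs := Rkhs { rkhs_val :> X -> C; _ : rkhs_val \in rkhs_mem }.
HB.instance Definition _ := [isSub for rkhs_val].
HB.instance Definition _ := [Choice of rkhs by <:].
HB.instance Definition _ := [SubChoice_isSubLmodule of rkhs by <:].

Lemma rkhs_repP (f : rkhs) : exists a, krep K f a.
Proof. by case: f => f /= /asboolP. Qed.

Definition rkhs_rep (f : rkhs) := sval (cid (rkhs_repP f)).

Lemma rkhs_repE (f : rkhs) : krep K f (rkhs_rep f).
Proof. exact: svalP (cid (rkhs_repP f)). Qed.

Definition rkhs_dot (f g : rkhs) : C :=
  sval (cid (kcauchy_form (rkhs_repE f).1 (rkhs_repE g).1)).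

Lemma rkhs_dotP (f g : rkhs) a b : krep K f a -> krep K g b ->
  kform K (a n) (b n) @[n --> \oo] --> rkhs_dot f g.
Proof.
move=> fa gb; apply: (krep_form_eq (rkhs_repE f) fa (rkhs_repE g) gb).
exact: (svalP (cid (kcauchy_form (rkhs_repE f).1 (rkhs_repE g).1))).
Qed.

Lemma rkhs_dotE (f g : rkhs) a b (l : C) : krep K f a -> krep K g b ->
  kform K (a n) (b n) @[n --> \oo] --> l -> rkhs_dot f g = l.
Proof.
move=> fa gb abl; exact: (norm_cvg_unique (rkhs_dotP fa gb) abl).
Qed.

Lemma rkhs_krepD (f g : rkhs) a b : krep K f a -> krep K g b ->
  krep K (f + g : rkhs) (fun n => a n ++ b n).
Proof.
have -> : rkhs_val (f + g) = (rkhs_val f + rkhs_val g) by [].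
exact: krepD.
Qed.

Lemma rkhs_krepZ z (f : rkhs) a : krep K f a ->
  krep K (z *: f : rkhs) (fun n => lscale z (a n)).
Proof.
have -> : rkhs_val (z *: f) = (z *: rkhs_val f) by [].
exact: krepZ.
Qed.

Lemma rkhs_krepB (f g : rkhs) a b : krep K f a -> krep K g b ->
  krep K (f - g : rkhs) (fun n => lsub (a n) (b n)).
Proof.
have -> : rkhs_val (f - g) = (rkhs_val f - rkhs_val g) by [].
exact: krepB.
Qed.

Lemma rkhs_dotDl (f g h : rkhs) : rkhs_dot (f + g) h = rkhs_dot f h + rkhs_dot g h.
Proof.
apply: (rkhs_dotE (rkhs_krepD (rkhs_repE f) (rkhs_repE g)) (rkhs_repE h)).
under eq_fun do rewrite kform_catl.
by apply: cvgD; apply: rkhs_dotP; exact: rkhs_repE.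
Qed.

Lemma rkhs_dotZl z (f h : rkhs) : rkhs_dot (z *: f) h = z * rkhs_dot f h.
Proof.
apply: (rkhs_dotE (rkhs_krepZ z (rkhs_repE f)) (rkhs_repE h)).
under eq_fun do rewrite kform_scalel.
by apply: cvgM; [exact: cvg_cst | apply: rkhs_dotP; exact: rkhs_repE].
Qed.

Lemma rkhs_dotC (f g : rkhs) : rkhs_dot f g = (rkhs_dot g f)^*.
Proof.
apply: (rkhs_dotE (rkhs_repE f) (rkhs_repE g)).
under eq_fun do rewrite kformC.
by apply: cvg_conjC; apply: rkhs_dotP; exact: rkhs_repE.
Qed.

Lemma rkhs_dot_ge0 (f : rkhs) : 0 <= rkhs_dot f f.
Proof.
apply: (cvg_ge0C (rkhs_dotP (rkhs_repE f) (rkhs_repE f))).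
by apply: nearW => n; exact: kform_ge0.
Qed.

Definition rkhs_of (l : seq (C * X)) : rkhs.
Proof. by exists (kev K l); apply/asboolP; exists (fun=> l); exact: krep_cst. Defined.

Lemma rkhs_ofE l : krep K (rkhs_of l) (fun=> l).
Proof. exact: krep_cst. Qed.

Lemma rkhs_dot_of l l' : rkhs_dot (rkhs_of l) (rkhs_of l') = kform K l l'.
Proof. by apply: rkhs_dotE; [exact: rkhs_ofE | exact: rkhs_ofE | exact: cvg_cst]. Qed.

Definition kpoint (x : X) : rkhs := rkhs_of [:: (1, x)].

Lemma rkhs_repro (f : rkhs) x : rkhs_dot f (kpoint x) = f x.
Proof.
exact: (rkhs_dotE (rkhs_repE f) (rkhs_ofE _) ((rkhs_repE f).2 x)).
Qed.

Lemma kpointE x y : rkhs_dot (kpoint x) (kpoint y) = K x y.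
Proof. by rewrite rkhs_dot_of /kform !big_seq1 /= rmorph1 !mul1r. Qed.

Definition rkhs_norm (f : rkhs) : C := sqrtC (rkhs_dot f f).

Lemma rkhs_norm2 f : rkhs_norm f ^+ 2 = rkhs_dot f f.
Proof. exact: sqrtCK. Qed.

Lemma rkhs_CS (f g : rkhs) : `|rkhs_dot f g| <= rkhs_norm f * rkhs_norm g.
Proof. exact: (inner_CS rkhs_dotDl rkhs_dotZl rkhs_dotC rkhs_dot_ge0). Qed.

Lemma ler_rkhs_normD f g : rkhs_norm (f + g) <= rkhs_norm f + rkhs_norm g.
Proof. exact: (inner_triangle rkhs_dotDl rkhs_dotZl rkhs_dotC rkhs_dot_ge0). Qed.

Lemma rkhs_normZ z f : rkhs_norm (z *: f) = `|z| * rkhs_norm f.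
Proof. exact: (inner_normZ rkhs_dotZl rkhs_dotC). Qed.

Lemma rkhs_norm_eq0 f : rkhs_norm f = 0 -> f = 0.
Proof.
move=> f0; apply/val_inj/funext => x /=; rewrite -rkhs_repro.
have := rkhs_CS f (kpoint x); rewrite f0 mul0r normr_le0 => /eqP ->.
by [].
Qed.

HB.instance Definition _ := Lmodule_isNormed.Build C rkhs
  ler_rkhs_normD rkhs_normZ rkhs_norm_eq0.

Lemma rkhs_normE (f : rkhs) : `|f| = sqrtC (rkhs_dot f f).
Proof. by []. Qed.

Lemma rkhs_of_sub l l' : rkhs_of l - rkhs_of l' = rkhs_of (lsub l l').
Proof.
apply/val_inj/funext => x /=.
rewrite /kev kform_subl //.
Qed.

Lemma rkhs_of_norm l : `|rkhs_of l| = knorm K l.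
Proof. by rewrite rkhs_normE rkhs_dot_of. Qed.

Lemma rkhs_cvg (f : rkhs) a : krep K f a -> rkhs_of (a n) @[n --> \oo] --> f.
Proof.
move=> fa; apply/cvgrPdist_le => e e0.
have [N aN] := fa.1 _ e0; exists N => // m /= Nm.
rewrite -(@ler_pXn2r _ 2 isT) ?nnegrE ?normr_ge0 ?(ltW e0) // (rkhs_norm2 (f - rkhs_of (a m))).
have fam := rkhs_krepB fa (rkhs_ofE (a m)).
(* The squared distance from [f] to [a m] is the limit over [n] of the squared norms of [a n - a m],
   so the bound [e ^+ 2] passes to it. *)
rewrite -subr_ge0; apply: (@cvg_ge0C R nat \oo _ (fun n =>
  e ^+ 2 - kform K (lsub (a n) (a m)) (lsub (a n) (a m)))).
  by apply: cvgB; [exact: cvg_cst | exact: rkhs_dotP].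
exists N => // n /= Nn; rewrite subr_ge0 -knormE ler_pXn2r ?nnegrE ?knorm_ge0 ?(ltW e0) //.
by rewrite ltW // aN.
Qed.

(** Formal sums [l n] are chosen within [1 / (n + 1)] of a set of [F]. Any two sets of [F] meet, so
    [l] is a Cauchy sequence; the function it represents is the limit of [F]. *)
Lemma rkhs_complete (F : set_system rkhs) : ProperFilter F -> cauchy F -> cvg F.
Proof.
move=> FF /cauchyP Fc.
have dense (f : rkhs) (e : C) : 0 < e -> exists l, `|f - rkhs_of l| < e.
  move=> e0; have := rkhs_cvg (rkhs_repE f) => /cvgrPdist_lt/(_ _ e0)[N _ H].
  by exists (rkhs_rep f N); exact: (H N (leqnn N)).
have d0 (n : nat) : 0 < n.+1%:R^-1 :> C by rewrite invr_gt0 ltr0n.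
have approx (n : nat) : exists l, F [set g : rkhs | `|rkhs_of l - g| < n.+1%:R^-1].
  have e2 : 0 < n.+1%:R^-1 / 2 :> C by rewrite divr_gt0.
  have [f Ff] := Fc _ e2; have [l fl] := dense f _ e2; exists l.
  apply: (@filterS _ F _ _ _ _ Ff) => g; rewrite -ball_normE /ball_ /= => fg.
  rewrite (_ : rkhs_of l - g = (f - g) - (f - rkhs_of l)); last first.
    by rewrite opprB [RHS]addrC addrA subrK.
  exact: (@normB_lt_half C rkhs _ _ _ fg fl).
have [l Fl] := choice approx.
have small (e : C) : 0 < e -> exists N, forall n, (N <= n)%N -> n.+1%:R^-1 < e.
  move=> /posC_real[r r0 ->]; have := @cvg_harmonic R.
  move/cvgrPdist_lt => /(_ _ r0)[N _ H]; exists N => n Nn.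
  have := H n Nn; rewrite /= sub0r normrN ger0_norm ?invr_ge0 // -ltcR.
  by rewrite fmorphV rmorph_nat.
have lc : kcauchy K l.
  move=> e e0; have [N Ne] := small _ (divr_gt0 e0 (ltr0n C 2)).
  exists N => m n Nm Nn.
  have [g [gm gn]] := filter_ex (filterI (Fl m) (Fl n)).
  rewrite -rkhs_of_norm -rkhs_of_sub (_ : rkhs_of (l m) - rkhs_of (l n) =
    (rkhs_of (l m) - g) - (rkhs_of (l n) - g)); last first.
    by rewrite opprB addrA subrK.
  apply: (@normB_lt_half C rkhs).
    exact: lt_trans gm (Ne _ Nm).
  exact: lt_trans gn (Ne _ Nn).
have [f fl] : exists f : X -> C, krep K f l.
  have ex x : exists z : C, kev K (l n) x @[n --> \oo] --> z.
    exact: (kcauchy_form lc (kcauchy_cst K [:: (1, x)])).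
  by have [f Hf] := choice ex; exists f.
have fm : f \in rkhs_mem by apply/asboolP; exists l.
apply/cvg_ex; exists (Rkhs fm); apply/cvgrPdist_lt => e e0.
have e2 := divr_gt0 e0 (ltr0n C 2).
have [N1 H1] := small _ e2.
have /cvgrPdist_lt/(_ _ e2)[N2 _ H2] := rkhs_cvg (f := Rkhs fm) fl.
pose n := maxn N1 N2.
apply: (@filterS _ F _ _ _ _ (Fl n)) => g lg.
rewrite (_ : Rkhs fm - g = (Rkhs fm - rkhs_of (l n)) + (rkhs_of (l n) - g)); last first.
  by rewrite addrA subrK.
apply: (@normD_lt_half C rkhs).
  by apply: H2; rewrite /= leq_maxr.
by apply: lt_trans lg (H1 _ _); rewrite leq_maxl.
Qed.

HB.instance Definition _ := Uniform_isComplete.Build rkhs rkhs_complete.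

Lemma rkhs_dot_linear v : linear_for *%R (rkhs_dot ^~ v).
Proof. by move=> z f g; rewrite rkhs_dotDl rkhs_dotZl. Qed.

Lemma rkhs_dot_norm f : rkhs_dot f f = `|f| ^+ 2.
Proof. by rewrite -rkhs_norm2. Qed.

HB.instance Definition _ := CompleteNormedModule_isHilbert.Build C rkhs
  rkhs_dot_linear rkhs_dotC rkhs_dot_norm.

Lemma rkhs_of_span l : lin_span (range kpoint) (rkhs_of l).
Proof.
exists (size l), (fun i => (tnth (in_tuple l) i).1), (fun i => kpoint (tnth (in_tuple l) i).2).
split; first by move=> i; eexists.
apply/val_inj/funext => x /=; rewrite -[LHS]/(kev K l x).
transitivity (rkhs_dot (\sum_i (tnth (in_tuple l) i).1 *: kpoint (tnth (in_tuple l) i).2)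
  (kpoint x)); last by rewrite rkhs_repro.
rewrite (big_morph (fun f => rkhs_dot f (kpoint x)) (fun f g => rkhs_dotDl f g _) (id1 := 0));
  last first.
  by rewrite -[0](scale0r (0 : rkhs)) rkhs_dotZl mul0r.
rewrite /kev /kform [LHS]big_tnth; apply: eq_bigr => i _.
by rewrite rkhs_dotZl kpointE big_seq1 /= rmorph1 mulr1.
Qed.

Lemma kpoint_total : total (range kpoint).
Proof.
apply/seteqP; split=> // f _ U Uf.
have [a fa] := rkhs_repP f.
have [N _ H] := rkhs_cvg fa Uf.
exists (rkhs_of (a N)); split; [exact: rkhs_of_span | exact: (H N (leqnn N))].
Qed.

End RKHS.

(** * Geometry of Hilbert spaces *)

Section HilbertBasics.
Variables (C : numClosedFieldType) (H : hilbertType C).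
Implicit Types (u v w : H) (z : C).

Lemma dotpC u v : dotp u v = (dotp v u)^*.
Proof. exact: dotp_conj. Qed.

Lemma dotpDl u v w : dotp (u + v) w = dotp u w + dotp v w.
Proof. by have := dotp_linearl w 1 u v; rewrite !scale1r mul1r. Qed.

Lemma dotp0l w : dotp 0 w = 0 :> C.
Proof. by apply: (@addrI _ (dotp 0 w)); rewrite -dotpDl !addr0. Qed.

Lemma dotpZl z u w : dotp (z *: u) w = z * dotp u w.
Proof. by have := dotp_linearl w z u 0; rewrite addr0 => ->; rewrite dotp0l addr0. Qed.

Lemma dotpNl u w : dotp (- u) w = - dotp u w.
Proof. by rewrite -scaleN1r dotpZl mulN1r. Qed.

Lemma dotpBl u v w : dotp (u - v) w = dotp u w - dotp v w.
Proof. by rewrite dotpDl dotpNl. Qed.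

Lemma dotpDr u v w : dotp w (u + v) = dotp w u + dotp w v.
Proof. by rewrite dotpC dotpDl rmorphD /= -!dotpC. Qed.

Lemma dotpZr z u w : dotp w (z *: u) = z^* * dotp w u.
Proof. by rewrite dotpC dotpZl rmorphM /= -dotpC. Qed.

Lemma dotp0r w : dotp w 0 = 0 :> C.
Proof. by rewrite dotpC dotp0l rmorph0. Qed.

Lemma dotpNr u w : dotp w (- u) = - dotp w u.
Proof. by rewrite dotpC dotpNl rmorphN /= -dotpC. Qed.

Lemma dotpBr u v w : dotp w (u - v) = dotp w u - dotp w v.
Proof. by rewrite dotpDr dotpNr. Qed.

Lemma dotp_suml (I : Type) (r : seq I) (P : pred I) (F : I -> H) w :
  dotp (\sum_(i <- r | P i) F i) w = \sum_(i <- r | P i) dotp (F i) w.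
Proof.
by apply: (big_morph (fun u => dotp u w)) => [u v|]; rewrite ?dotpDl ?dotp0l.
Qed.

Lemma dotp_sumr (I : Type) (r : seq I) (P : pred I) (F : I -> H) w :
  dotp w (\sum_(i <- r | P i) F i) = \sum_(i <- r | P i) dotp w (F i).
Proof.
by apply: (big_morph (fun u => dotp w u)) => [u v|]; rewrite ?dotpDr ?dotp0r.
Qed.

Lemma dotp_ge0 u : 0 <= dotp u u.
Proof. by rewrite dotp_norm exprn_ge0. Qed.

Lemma dotp_eq0 u : dotp u u = 0 -> u = 0.
Proof. by rewrite dotp_norm => /eqP; rewrite sqrf_eq0 normr_eq0 => /eqP. Qed.

Lemma dotp_CS u v : `|dotp u v| <= `|u| * `|v|.
Proof.
have := inner_CS dotpDl dotpZl dotpC dotp_ge0 u v.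
by rewrite !dotp_norm !sqrCK.
Qed.

Lemma gram_ge0 (Y : Type) (f : Y -> H) (a : seq (C * Y)) :
  0 <= \sum_(p <- a) \sum_(q <- a) p.1 * q.1^* * dotp (f p.2) (f q.2).
Proof.
suff -> : \sum_(p <- a) \sum_(q <- a) p.1 * q.1^* * dotp (f p.2) (f q.2) =
    dotp (\sum_(p <- a) p.1 *: f p.2) (\sum_(p <- a) p.1 *: f p.2) by exact: dotp_ge0.
rewrite dotp_suml; apply: eq_bigr => p _; rewrite dotp_sumr; apply: eq_bigr => q _.
by rewrite dotpZl dotpZr mulrA.
Qed.

Lemma normsqB u v : `|u - v| ^+ 2 = `|u| ^+ 2 - dotp u v - dotp v u + `|v| ^+ 2.
Proof. by rewrite -!dotp_norm dotpBl !dotpBr; ring. Qed.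

Lemma cvg_dotpr (T : Type) (F : set_system T) {FF : Filter F} (f : T -> H) u w :
  f @ F --> u -> dotp w (f x) @[x --> F] --> dotp w u.
Proof.
move=> fu; apply/cvgrPdist_lt => e e0.
have w1 : 0 < `|w| + 1 by rewrite ltr_wpDl.
move/cvgrPdist_lt : fu => /(_ _ (divr_gt0 e0 w1)); apply: filterS => x ux.
rewrite -dotpBr; apply: (le_lt_trans (dotp_CS _ _)).
apply: le_lt_trans (_ : (`|w| + 1) * `|u - f x| < e); first by rewrite ler_wpM2r // lerDl.
by rewrite mulrC -ltr_pdivlMr.
Qed.

Lemma cvg_dotpl (T : Type) (F : set_system T) {FF : Filter F} (f : T -> H) u w :
  f @ F --> u -> dotp (f x) w @[x --> F] --> dotp u w.
Proof.
move=> fu; apply/cvgrPdist_lt => e e0.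
have : dotp w (f x) @[x --> F] --> dotp w u by exact: cvg_dotpr.
move/cvgrPdist_lt => /(_ _ e0); apply: filterS => x.
by rewrite -dotpBr -dotpBl [dotp (_ - _) _]dotpC norm_conjC.
Qed.

Lemma closureP (A : set H) v : closure A v <-> forall e : C, 0 < e -> exists2 a, A a & `|v - a| < e.
Proof.
split=> [cA e e0|cA U].
  have := cA _ (nbhsx_ballx v _ e0) => -[a [Aa]].
  by rewrite -ball_normE => va; exists a.
rewrite -nbhs_ballE => -[e /= e0 eU]; have [a Aa va] := cA _ e0.
by exists a; split => //; apply: eU; rewrite -ball_normE.
Qed.

Lemma small_eq0 v : (forall e : C, 0 < e -> `|v| <= e) -> v = 0.
Proof.
move=> H0; apply/eqP; rewrite -normr_eq0; apply/eqP/le_anti; rewrite normr_ge0 andbT.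
have [->//|n0] := eqVneq `|v| 0.
have p : 0 < `|v| by rewrite lt_neqAle eq_sym n0 normr_ge0.
have := H0 _ (divr_gt0 p (ltr0n C 2)).
by rewrite ler_pdivlMr // -{2}[`|v|]mulr1 ler_pM2l // lern1.
Qed.

Lemma lin_span_ortho (A : set H) w : (forall a, A a -> dotp a w = 0) ->
  forall v, lin_span A v -> dotp v w = 0.
Proof.
move=> Aw _ [n [c [x [Ax ->]]]]; rewrite dotp_suml big1 // => i _.
by rewrite dotpZl Aw // mulr0.
Qed.

Lemma total_ortho (A : set H) w : total A -> (forall a, A a -> dotp a w = 0) -> w = 0.
Proof.
move=> tA Aw; have [//|wn0] := eqVneq w 0.
apply: small_eq0 => e e0.
have : closure (lin_span A) w by rewrite tA.
move=> /closureP/(_ _ e0)[a Aa wa].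
have w0 : 0 < `|w| by rewrite normr_gt0.
rewrite -(ler_pM2r w0) -expr2 -dotp_norm -[dotp w w]subr0 -(lin_span_ortho Aw Aa) -dotpBl.
rewrite -[leLHS]ger0_norm; last by rewrite dotpBl (lin_span_ortho Aw Aa) subr0 dotp_ge0.
by apply: (le_trans (dotp_CS _ _)); rewrite ler_wpM2r // ltW.
Qed.

Lemma total_ortho_eq (A : set H) v w : total A ->
  (forall a, A a -> dotp a v = dotp a w) -> v = w.
Proof.
move=> tA Aw; apply/eqP; rewrite -subr_eq0; apply/eqP; apply: (total_ortho tA) => a Aa.
by rewrite dotpBr Aw // subrr.
Qed.

Definition orthonormal n (e : 'I_n -> H) := forall i j, dotp (e i) (e j) = (i == j)%:R :> C.

Definition expands n (e : 'I_n -> H) v := v = \sum_i dotp v (e i) *: e i.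

Lemma orthonormal_coord n (e : 'I_n -> H) (c : 'I_n -> C) j : orthonormal e ->
  dotp (\sum_i c i *: e i) (e j) = c j.
Proof.
move=> oe; rewrite dotp_suml (bigD1 j) //= dotpZl oe eqxx mulr1 big1 ?addr0 // => i ij.
by rewrite dotpZl oe (negbTE ij) mulr0.
Qed.

Lemma orthonormal_expands n (e : 'I_n -> H) (c : 'I_n -> C) : orthonormal e ->
  expands e (\sum_i c i *: e i).
Proof. by move=> oe; apply: eq_bigr => i _; rewrite orthonormal_coord. Qed.

Lemma expands_dotp n (e : 'I_n -> H) u v : expands e u ->
  dotp u v = \sum_i dotp u (e i) * dotp (e i) v.
Proof. by move=> eu; rewrite {1}eu dotp_suml; apply: eq_bigr => i _; rewrite dotpZl. Qed.

Lemma bessel n (e : 'I_n -> H) v : orthonormal e ->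
  \sum_i `|dotp v (e i)| ^+ 2 <= `|v| ^+ 2.
Proof.
move=> oe; set p := \sum_i dotp v (e i) *: e i.
have vp : dotp v p = \sum_i `|dotp v (e i)| ^+ 2.
  by rewrite dotp_sumr; apply: eq_bigr => i _; rewrite dotpZr normCK mulrC.
have pv : dotp p v = \sum_i `|dotp v (e i)| ^+ 2.
  by rewrite dotp_suml; apply: eq_bigr => i _; rewrite dotpZl normCK [dotp (e i) v]dotpC.
have pp : dotp p p = \sum_i `|dotp v (e i)| ^+ 2.
  rewrite (expands_dotp p (orthonormal_expands _ oe)); apply: eq_bigr => i _.
  by rewrite [dotp (e i) p]dotpC orthonormal_coord // normCK.
have := dotp_ge0 (v - p); rewrite dotpBl !dotpBr vp pv pp subrr subr0 subr_ge0.
by rewrite dotp_norm.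
Qed.

(** One Gram-Schmidt step. The last clause gives the new vector explicitly, so that
    [finite_orthonormal_basis] can check that it stays in the subspace. *)
Lemma orthonormal_extend n (e : 'I_n -> H) v : orthonormal e -> ~ expands e v ->
  exists e' : 'I_n.+1 -> H, [/\ orthonormal e',
    forall u, expands e u -> expands e' u, expands e' v &
    forall i, e' i = if unlift ord0 i is Some j then e j else
      `|v - \sum_i dotp v (e i) *: e i|^-1 *: (v - \sum_i dotp v (e i) *: e i)].
Proof.
move=> oe nv; set p := \sum_i _; set w := v - p.
have w0 : w != 0 by rewrite subr_eq0; apply/eqP.
have nw : `|w| != 0 by rewrite normr_eq0.
have we i : dotp w (e i) = 0 by rewrite dotpBl orthonormal_coord // subrr.
have ew i : dotp (e i) w = 0 by rewrite dotpC we rmorph0.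
pose e' i := if unlift ord0 i is Some j then e j else `|w|^-1 *: w.
have e'0 : e' ord0 = `|w|^-1 *: w by rewrite /e' unlift_none.
have e'S j : e' (lift ord0 j) = e j by rewrite /e' liftK.
have cw : (`|w|^-1)^* = `|w|^-1 by apply/CrealP/ger0_real; rewrite invr_ge0.
have oe' : orthonormal e'.
  move=> i j; case: (unliftP ord0 i) => [i'|] ->; case: (unliftP ord0 j) => [j'|] ->;
    rewrite ?e'S ?e'0 ?dotpZl ?dotpZr ?we ?ew ?mulr0 //.
  by rewrite dotp_norm cw eqxx expr2 mulKf // mulVf.
have ex' u : u = \sum_i dotp u (e i) *: e i + (dotp u w / `|w| ^+ 2) *: w -> expands e' u.
  move=> ->; rewrite /expands.
  suff E : \sum_i dotp u (e i) *: e i + (dotp u w / `|w| ^+ 2) *: w =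
    \sum_i (if unlift ord0 i is Some j then dotp u (e j) else dotp u w / `|w|) *: e' i.
    by rewrite E; exact: orthonormal_expands.
  rewrite big_ord_recl /= unlift_none e'0 addrC; congr (_ + _).
    by rewrite scalerA expr2 invfM mulrA.
  by apply: eq_bigr => i _; rewrite liftK e'S.
exists e'; split => // [u eu|].
  apply: ex'; have -> : dotp u w = 0.
    by rewrite (expands_dotp w eu) big1 // => i _; rewrite ew mulr0.
  by rewrite mul0r scale0r addr0.
apply: ex'; suff -> : dotp v w = `|w| ^+ 2.
  by rewrite divff ?expf_neq0 // scale1r /w addrC subrK.
rewrite -dotp_norm {2}/w dotpBl -[LHS]subr0; congr (_ - _).
by rewrite dotp_suml big1 // => i _; rewrite dotpZl ew mulr0.
Qed.

Lemma gram_schmidt (s : seq H) : exists n (e : 'I_n -> H),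
  orthonormal e /\ forall v, v \in s -> expands e v.
Proof.
elim: s => [|x s [n [e [oe es]]]].
  by exists 0%N, (fun=> 0); split => // -[].
have [ex|nx] := pselect (expands e x).
  by exists n, e; split => // v; rewrite inE => /orP[/eqP ->|/es].
have [e' [oe' e'e e'x _]] := orthonormal_extend oe nx.
by exists n.+1, e'; split => // v; rewrite inE => /orP[/eqP ->|/es/e'e].
Qed.

Definition linear_subspace (E : set H) :=
  E 0 /\ forall z u v, E u -> E v -> E (z *: u + v).

Lemma linear_subspace_sum (E : set H) n (c : 'I_n -> C) (x : 'I_n -> H) :
  linear_subspace E -> (forall i, E (x i)) -> E (\sum_i c i *: x i).
Proof.
move=> [E0 EZD] Ex; elim/big_ind: _ => // [u v Eu Ev|i _].
  by rewrite -[u]scale1r; exact: EZD.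
by rewrite -[_ *: _]addr0; exact: EZD.
Qed.

(** Finite dimension is expressed by a bound on the length of orthonormal families. A family of
    maximal length spans [E], since [orthonormal_extend] would otherwise lengthen it inside [E]. *)
Lemma finite_orthonormal_basis (E : set H) N : linear_subspace E ->
  (forall n (e : 'I_n -> H), orthonormal e -> (forall i, E (e i)) -> (n <= N)%N) ->
  exists n (e : 'I_n -> H), [/\ orthonormal e, forall i, E (e i) &
    forall v, E v -> expands e v].
Proof.
move=> sE bd.
pose P n := `[< exists e : 'I_n -> H, orthonormal e /\ forall i, E (e i) >].
have exP : exists n, P n by exists 0%N; apply/asboolP; exists (fun=> 0); split => -[].
have bdP n : P n -> (n <= N)%N by move=> /asboolP[e [oe Ee]]; exact: bd oe Ee.
case: (ex_maxnP exP bdP) => n /asboolP[e [oe Ee]] mx.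
exists n, e; split => // v Ev; apply: contrapT => nv.
have [e' [oe' _ _ e'E]] := orthonormal_extend oe nv.
have : P n.+1.
  apply/asboolP; exists e'; split => // i; rewrite e'E; case: unliftP => [j|] _ //.
  have Ep : E (\sum_i dotp v (e i) *: e i) by exact: linear_subspace_sum.
  rewrite -[_ *: _]addr0; apply: sE.2; last exact: sE.1.
  by rewrite addrC -scaleN1r; apply: sE.2.
by move=> /mx; rewrite ltnn.
Qed.

End HilbertBasics.

(** * Riesz representation by minimising an energy *)

Section MinimumPrinciple.
Variables (C : numClosedFieldType) (H : hilbertType C) (f : H -> C).
Hypothesis f_lin : forall z u v, f (z *: u + v) = z * f u + f v.

Lemma quadratic_eq0 (A c : C) : 0 <= A ->
  (forall z, 0 <= `|z| ^+ 2 * A + z * c + (z * c)^*) -> c = 0.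
Proof.
move=> A0 Hc; have [//|c0] := eqVneq c 0; exfalso.
have A1 : 0 < A + 1 by rewrite ltr_wpDl.
(* At [z = - t * c^*] the expression is [- t |c|^2 (2 - t A)]: for small [t] the linear term
   outweighs the quadratic one. *)
have [t t0 tA] : exists2 t : C, 0 < t & t * A < 2.
  exists (A + 1)^-1; first by rewrite invr_gt0.
  apply: (@le_lt_trans _ _ 1); last by rewrite ltrDl ltr01.
  by rewrite mulrC ler_pdivrMr // mul1r lerDl ler01.
have tr : t^* = t by apply/CrealP/ger0_real/ltW.
have := Hc (- (t * c^*)).
have -> : `|- (t * c^*)| ^+ 2 * A + - (t * c^*) * c + (- (t * c^*) * c)^* =
    - (t * `|c| ^+ 2 * (2 - t * A)).
  rewrite normrN normrM norm_conjC (ger0_norm (ltW t0)) !(rmorphM, rmorphN) /= conjCK.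
  by rewrite tr exprMn !normCK; ring.
rewrite oppr_ge0 => h; have : 0 < t * `|c| ^+ 2 * (2 - t * A).
  rewrite !mulr_gt0 ?exprn_gt0 ?normr_gt0 // subr_gt0 //.
by move=> /lt_le_trans/(_ h); rewrite ltxx.
Qed.

Definition energy v : C := dotp v v - f v - (f v)^*.

Lemma energy_real v : energy v \is Num.real.
Proof.
have -> : energy v = dotp v v - 'Re (f v) *+ 2 by rewrite ReE /energy; field.
by rewrite rpredB ?rpredMn ?Creal_Re // ger0_real ?dotp_ge0.
Qed.

Lemma functionalD u v : f (u + v) = f u + f v.
Proof. by rewrite -[u]scale1r f_lin scale1r mul1r. Qed.

Lemma functional0 : f 0 = 0.
Proof. by apply: (@addrI _ (f 0)); rewrite -functionalD !addr0. Qed.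

Lemma functionalZ z u : f (z *: u) = z * f u.
Proof. by rewrite -[z *: u]addr0 f_lin functional0 addr0. Qed.

Lemma energy_cvg (T : Type) (F : set_system T) {FF : Filter F} (x : T -> H) v :
  x @ F --> v -> f (x t) @[t --> F] --> f v -> energy (x t) @[t --> F] --> energy v.
Proof.
move=> xv fx; apply: cvgB; last exact: cvg_conjC.
apply: cvgB; last exact: fx.
have -> : (fun t => dotp (x t) (x t)) = (fun t => `|x t| * `|x t|).
  by apply/funext => n; rewrite dotp_norm expr2.
by rewrite dotp_norm expr2; apply: cvgM; exact: cvg_norm.
Qed.

(** Minimising sequences are Cauchy by this identity: if [u] and [v] have energy within [d] of the
    infimum, then, as the midpoint has at least the infimum, [|u - v|^2 <= 4 d]. *)
Lemma energy_parallelogram u v :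
  `|u - v| ^+ 2 = 2 * energy u + 2 * energy v - 4 * energy (2^-1 *: (u + v)).
Proof.
rewrite -dotp_norm /energy !functionalZ !functionalD !dotpZl !dotpZr.
rewrite dotpBl !dotpBr dotpDl !dotpDr !rmorphM !rmorphD /= !fmorphV !rmorph_nat.
by field.
Qed.

(** Completing the square: [|v|^2 - 2 M |v| >= - M^2]. *)
Lemma energy_ge (M : C) v : 0 <= M -> `|f v| <= M * `|v| -> - (M ^+ 2) <= energy v.
Proof.
move=> M0 fM; have -> : energy v = `|v| ^+ 2 - 'Re (f v) *+ 2.
  by rewrite ReE /energy dotp_norm; field.
have Rf : 'Re (f v) *+ 2 <= M * `|v| *+ 2.
  by rewrite lerMn2r /=; apply: le_trans fM; exact: (leif_Re_Creal _).1.
rewrite -subr_ge0 opprK addrAC subr_ge0; apply: (le_trans Rf).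
rewrite -subr_ge0 (_ : _ - _ = (`|v| - M) ^+ 2); last by ring.
by rewrite real_exprn_even_ge0 // rpredB ?normr_real // ger0_real.
Qed.

Lemma energy_minimum (S : set H) v : linear_subspace S -> S v ->
  (forall w, S w -> energy v <= energy w) -> forall w, S w -> dotp w v = f w.
Proof.
move=> [_ SZD] Sv vmin w Sw; apply/eqP; rewrite -subr_eq0; apply/eqP.
apply: (@quadratic_eq0 (dotp w w)); first exact: dotp_ge0.
move=> z; have := vmin (z *: w + v) (SZD _ _ _ Sw Sv); rewrite -subr_ge0.
congr (0 <= _); rewrite /energy f_lin dotpDl !dotpDr !dotpZl !dotpZr.
by rewrite [dotp v w]dotpC normCK !(rmorphD, rmorphN, rmorphM, rmorphB) /=; ring.
Qed.

End MinimumPrinciple.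

Section Riesz.
Variables (R : realType).
Notation C := (R[i] : numClosedFieldType).
Variables (H : hilbertType C) (S : set H) (f : H -> C).

(* The representing vector minimises [v |-> |v|^2 - 2 Re (f v)] on [S]. *)
Lemma riesz (M : C) : closed S -> linear_subspace S ->
  (forall z u v, f (z *: u + v) = z * f u + f v) ->
  (forall w, `|f w| <= M * `|w|) ->
  exists v, S v /\ forall w, S w -> dotp w v = f w.
Proof.
move=> Sc Sl fl fM.
wlog M0 : M fM / 0 < M.
  move=> h; apply: (h (`|M| + 1)); last by rewrite ltr_wpDl.
  move=> w; apply: (le_trans (fM w)).
  rewrite -[leLHS]ger0_norm; last exact: le_trans (normr_ge0 _) (fM w).
  by rewrite normrM normr_id ler_wpM2r // lerDl.
pose phi := energy f.
(* The energy is real; it is moved to [R], where infima exist. *)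
have [r rE] : exists r : H -> R, forall v, phi v = ((r v)%:C)%C :> C.
  exists (fun v => complex.Re (phi v)) => v.
  by rewrite RRe_real //; exact: energy_real.
pose E := r @` S.
have E0 : E !=set0 by exists (r 0); exists 0 => //; exact: Sl.1.
have lbE : has_lbound E.
  exists (complex.Re (- (M ^+ 2))) => _ [v Sv <-].
  have := energy_ge (ltW M0) (fM v); rewrite -/(phi v) rE lecE => /andP[_].
  by [].
have hE : has_inf E by [].
have approx (n : nat) : exists v, S v /\ r v < inf E + n.+1%:R^-1.
  have n0 : 0 < n.+1%:R^-1 :> R by rewrite invr_gt0.
  have [_ [v Sv <-] lt] := inf_adherent n0 hE.
  by exists v.
have [x Hx] := choice approx.
have lower v : S v -> inf E <= r v by move=> Sv; apply: ge_inf => //; exists v.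
have mid u v : S u -> S v -> S (2^-1 *: (u + v)).
  move=> Su Sv; rewrite scalerDr; apply: Sl.2 => //.
  by rewrite -[_ *: v]addr0; apply: Sl.2 => //; exact: Sl.1.
have small (e : R) : 0 < e -> exists N, forall n, (N <= n)%N -> r (x n) < inf E + e.
  move=> e0; have /cvgrPdist_lt/(_ _ e0)[N _ HN] := @cvg_harmonic R.
  exists N => n Nn; apply: (lt_trans (Hx n).2); rewrite ltrD2l.
  by have := HN n Nn; rewrite /= sub0r normrN ger0_norm ?invr_ge0.
have xc : cauchy (x n @[n --> \oo]).
  apply/cauchyP => _ /posC_real[e e0 ->].
  have e4 : 0 < e ^+ 2 / 4 by rewrite divr_gt0 ?exprn_gt0.
  have [N HN] := small _ e4; exists (x N); exists N => // n /= Nn.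
  rewrite -ball_normE /ball_ /=.
  have e0' : 0 <= (e%:C)%C :> C by rewrite ler0c ltW.
  rewrite -(@ltr_pXn2r C 2 isT) ?nnegrE ?normr_ge0 //.
  rewrite (energy_parallelogram fl) -/phi !rE.
  have -> : 2 * ((r (x N))%:C)%C + 2 * ((r (x n))%:C)%C - 4 * ((r (2^-1 *: (x N + x n)))%:C)%C
     = ((2 * r (x N) + 2 * r (x n) - 4 * r (2^-1 *: (x N + x n)))%:C)%C :> C.
    by rewrite rmorphB rmorphD !rmorphM !rmorph_nat.
  rewrite -rmorphXn ltcR.
  have h1 := HN _ (leqnn N); have h2 := HN _ Nn.
  have h3 := lower _ (mid _ _ (Hx N).1 (Hx n).1).
  lra.
have /cvg_ex[v xv] : cvg (x n @[n --> \oo]) by exact: cauchy_cvg.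
have Sv : S v.
  have xS : \forall n \near \oo, S (x n) by apply: nearW => n; exact: (Hx n).1.
  exact: closed_cvg Sc xS v xv.
have fx : f (x n) @[n --> \oo] --> f v.
  apply/cvgrPdist_lt => e e0.
  move/cvgrPdist_lt : xv => /(_ _ (divr_gt0 e0 M0)); apply: filterS => n vn.
  have -> : f v - f (x n) = f (v - x n).
    by rewrite (functionalD fl) -[- x n]scaleN1r (functionalZ fl) mulN1r.
  by apply: (le_lt_trans (fM _)); rewrite mulrC -ltr_pdivlMr.
have phix : phi (x n) @[n --> \oo] --> phi v.
  exact: energy_cvg.
have rv : r v <= inf E.
  apply/ler_addgt0Pr => e e0; have [N HN] := small _ e0.
  rewrite -lecR -rE -subr_ge0.
  apply: (@cvg_ge0C R nat \oo _ (fun n => ((inf E + e)%:C)%C - phi (x n))).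
    by apply: cvgB; [exact: cvg_cst | exact: phix].
  by exists N => // n /= Nn; rewrite subr_ge0 rE lecR ltW // HN.
exists v; split=> // w Sw; apply: (energy_minimum fl Sl Sv _ Sw) => u Su.
by rewrite -/phi !rE lecR; exact: le_trans rv (lower _ Su).
Qed.

End Riesz.

(** * Representations from invariant kernels *)

(** For vectors of equal norm [|v - u|^2] is twice the real part of [<v, v> - <u, v>]. This turns
    continuity of coefficients into strong continuity. *)
Lemma dist_lt_dotp (C : numClosedFieldType) (H : hilbertType C) (u v : H) (e : C) :
  0 < e -> dotp u u = dotp v v -> `|dotp v v - dotp u v| < e ^+ 2 / 2 -> `|v - u| < e.
Proof.
move=> e0 uv d; rewrite -(@ltr_pXn2r C 2 isT) ?nnegrE ?normr_ge0 ?(ltW e0) //.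
rewrite normsqB -!dotp_norm uv.
have -> : dotp v v - dotp v u - dotp u v + dotp v v =
  (dotp v v - dotp u v) + (dotp v v - dotp u v)^*.
  by rewrite rmorphB /= -!dotpC; ring.
rewrite -[ltLHS]ger0_norm; first by apply: normD_lt_half => //; rewrite norm_conjC.
have -> : dotp v v - dotp u v + (dotp v v - dotp u v)^* = `|v - u| ^+ 2.
  by rewrite rmorphB /= -!dotpC normsqB -!dotp_norm uv; ring.
exact: exprn_ge0.
Qed.

Section IsometricContinuity.
Variables (C : numClosedFieldType) (G : topologicalType) (H : hilbertType C).
Variables (T : G -> {linear H -> H}).
Hypothesis T_dotp : forall x u v, dotp (T x u) (T x v) = dotp u v.

Lemma isometry_norm x v : `|T x v| = `|v|.
Proof. by apply: (@pexpIrn _ 2 isT); rewrite ?nnegrE // -!dotp_norm T_dotp. Qed.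

(** Because all [T x] are isometries, approximating [v] by the span of [A] costs the same error at
    every [x]. *)
Lemma isometric_continuous (A : set H) : total A ->
  (forall a, A a -> continuous (fun x => T x a)) -> forall v, continuous (fun x => T x v).
Proof.
move=> tA Ac.
have Sc v : lin_span A v -> continuous (fun x => T x v).
  move=> [n [c [a [Aa ->]]]] x; rewrite /continuous_at.
  have -> : (fun x => T x (\sum_i c i *: a i)) = (fun x => \sum_i c i *: T x (a i)).
    by apply/funext => y; rewrite linear_sum; apply: eq_bigr => i _; rewrite linearZ.
  have -> : T x (\sum_i c i *: a i) = \sum_i c i *: T x (a i).
    by rewrite linear_sum; apply: eq_bigr => i _; rewrite linearZ.
  apply: cvg_big => [|i _]; first exact: add_continuous.
  by apply: cvgZ; [exact: cvg_cst | exact: Ac].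
move=> v x; apply/cvgrPdist_lt => e e0.
have e3 : 0 < e / 2 / 2 by rewrite !divr_gt0.
have : closure (lin_span A) v by rewrite tA.
move=> /closureP/(_ _ e3)[s Ss vs].
have /cvgrPdist_lt/(_ _ (divr_gt0 e0 (ltr0n C 2))) := Sc s Ss x; apply: filterS => y xy.
have -> : T x v - T y v = (T x (v - s) - T y (v - s)) + (T x s - T y s).
  rewrite (linearB (T x)) (linearB (T y)). 
  by rewrite opprB [RHS]addrAC ![in RHS]addrA !subrK.
apply: normD_lt_half => //; apply: normB_lt_half; rewrite isometry_norm //.
Qed.

End IsometricContinuity.

Section KernelRepresentation.
Variables (R : realType) (G : topGroupType) (X : Type).
Notation C := (R[i] : numClosedFieldType).
Variables (K : pd_kernel C X) (act : G -> X -> X).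
Hypothesis act1 : forall x, act 1%g x = x.
Hypothesis actM : forall g h x, act (g * h)%g x = act g (act h x).
Hypothesis actK : forall g x y, K (act g x) (act g y) = K x y.
Hypothesis act_cont : forall x y, continuous (fun g => K (act g x) y : C).

Definition lact g (a : seq (C * X)) := [seq (p.1, act g p.2) | p <- a].

Lemma actVK g (x : X) : act g (act (g^-1)%g x) = x.
Proof. by rewrite -actM mulgV act1. Qed.

Lemma kform_act g a b : kform K (lact g a) (lact g b) = kform K a b.
Proof.
rewrite /kform big_map; apply: eq_bigr => p _; rewrite big_map.
by apply: eq_bigr => q _; rewrite actK.
Qed.

Lemma kev_act g a x : kev K (lact g a) x = kev K a (act (g^-1)%g x).
Proof. by rewrite /kev -[in LHS](actVK g x) -(kform_act g a [:: (1, _)]). Qed.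

Lemma krep_act g (f : X -> C) a : krep K f a ->
  krep K (fun x => f (act (g^-1)%g x)) (fun n => lact g (a n)).
Proof.
move=> [ac af]; split=> [e e0|x].
  have [N HN] := ac e e0; exists N => m n Nm Nn; rewrite -/(lact g).
  have -> : knorm K (lsub (lact g (a m)) (lact g (a n))) = knorm K (lsub (a m) (a n)).
    by congr sqrtC; rewrite !(kform_catl, kform_catr, kform_scalel, kform_scaler) !kform_act.
  exact: HN.
by under eq_fun do rewrite kev_act; exact: af.
Qed.

Fact rkhs_act_subproof g (f : rkhs K) : (fun x => f (act (g^-1)%g x)) \in rkhs_mem K.
Proof.
have [a fa] := rkhs_repP f; apply/asboolP.
by exists (fun n => lact g (a n)); exact: krep_act.
Qed.

Definition rkhs_act g (f : rkhs K) : rkhs K := Rkhs (rkhs_act_subproof g f).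

Fact rkhs_act_linear g : linear (rkhs_act g).
Proof. by move=> z u v; apply/val_inj. Qed.

HB.instance Definition _ g :=
  GRing.isLinear.Build C (rkhs K) (rkhs K) *:%R (rkhs_act g) (rkhs_act_linear g).

Lemma rkhs_act_dotp g (u v : rkhs K) : dotp (rkhs_act g u) (rkhs_act g v) = dotp u v.
Proof.
have [a ua] := rkhs_repP u; have [b vb] := rkhs_repP v.
have ua' : krep K (rkhs_act g u) (fun n => lact g (a n)) by exact: krep_act.
have vb' : krep K (rkhs_act g v) (fun n => lact g (b n)) by exact: krep_act.
rewrite -[LHS]/(rkhs_dot (rkhs_act g u) (rkhs_act g v)).
apply: (rkhs_dotE ua' vb').
under eq_fun do rewrite kform_act.
exact: rkhs_dotP.
Qed.

Lemma rkhs_act_point g x : rkhs_act g (kpoint K x) = kpoint K (act g x).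
Proof.
apply/val_inj/funext => y /=.
by rewrite /kev /kform !big_seq1 /= -(actK g x) actVK.
Qed.

Lemma rkhs_act_cont_point x : continuous (fun g => rkhs_act g (kpoint K x)).
Proof.
move=> h; rewrite /continuous_at; apply/cvgrPdist_lt => e e0.
have e2 : 0 < e ^+ 2 / 2 by rewrite divr_gt0 ?exprn_gt0.
have hc : K (act g x) (act h x) @[g --> h] --> K (act h x) (act h x) by exact: act_cont.
move/cvgrPdist_lt : hc => /(_ _ e2); apply: filterS => g; rewrite !rkhs_act_point => gh.
have dE (x1 x2 : X) : dotp (kpoint K x1) (kpoint K x2) = K x1 x2 by exact: kpointE.
apply: (@dist_lt_dotp C (rkhs K) _ _ _ e0); first by rewrite !dE !actK.
by rewrite !dE.
Qed.

(** The common source of the GNS, direct sum, Kronecker and gap representations below; each of them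
    only has to exhibit an invariant kernel. *)
Lemma kernel_rep : exists (H : hilbertType C) (phi : X -> H) (pi : unitary_rep G H),
  [/\ forall x y, dotp (phi x) (phi y) = K x y, total (range phi) &
      forall g x, pi g (phi x) = phi (act g x)].
Proof.
have pi1 v : rkhs_act 1%g v = v.
  by apply/val_inj/funext => x /=; rewrite invg1 act1.
have piM g h v : rkhs_act (g * h)%g v = rkhs_act g (rkhs_act h v).
  by apply/val_inj/funext => x /=; rewrite invgM actM.
have pic v : continuous (fun g => rkhs_act g v).
  apply: (@isometric_continuous C G (rkhs K) (fun g => rkhs_act g) rkhs_act_dotp _
    (kpoint_total K)).
  by move=> _ [x _ <-]; exact: rkhs_act_cont_point.
exists (rkhs K), (kpoint K).
exists (@UnitaryRep C G (rkhs K) (fun g => rkhs_act g) pi1 piM rkhs_act_dotp pic).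
split; [exact: kpointE | exact: kpoint_total | exact: rkhs_act_point].
Qed.

End KernelRepresentation.

Section PositiveDefinite.
Variables (C : numClosedFieldType) (G : topGroupType) (u : G -> C).
Hypothesis pd : positive_definite u.

Lemma positive_definite_seq (a : seq (C * G)) :
  0 <= \sum_(p <- a) \sum_(q <- a) p.1 * q.1^* * u (q.2^-1 * p.2)%g.
Proof.
rewrite big_tnth.
under eq_bigr do rewrite big_tnth.
exact: (@pd (size a) (fun i => (tnth (in_tuple a) i).1) (fun i => (tnth (in_tuple a) i).2)).
Qed.

(** Positivity on the points [x] and [1] makes [z u(x) + z^* u(x^-1)] real for every [z]; the cases
    [z = 1] and [z = 'i] together give the claim. *)
Lemma positive_definiteV x : u (x^-1)%g = (u x)^*.
Proof.
have u1 : u 1%g \is Num.real.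
  have := positive_definite_seq [:: (1, 1%g)].
  by rewrite !big_seq1 /= rmorph1 !mul1r mulg1 invg1; exact: ger0_real.
have key (z : C) : z * u x + z^* * u (x^-1)%g \is Num.real.
  have := positive_definite_seq [:: (z, x); (1, 1%g)].
  rewrite !(big_cons, big_nil) /= rmorph1 !mulr1 !mul1r !addr0 mulVg !invg1 mulg1 mul1g mulg1.
  set s := (X in 0 <= X) => /ger0_real s_real.
  have -> : z * u x + z^* * u (x^-1)%g = s - z * z^* * u 1%g - u 1%g by rewrite /s; ring.
  rewrite !rpredB // rpredM // -normCK ger0_real // exprn_ge0 //.
have /CrealP k1 := key 1; have /CrealP ki := key 'i.
move: k1 ki; rewrite !(rmorphD, rmorphM, rmorph1) /= conjCi !rmorphN /= conjCi !mul1r => k1 ki.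
have i0 : ('i : C) != 0 by exact: neq0Ci.
have k1' : (u x)^* + (u (x^-1)%g)^* - (u x + u (x^-1)%g) = 0.
  by apply/eqP; rewrite subr_eq0; apply/eqP; rewrite -[RHS]k1.
have ki' : - 'i * (u x)^* + 'i * (u (x^-1)%g)^* - ('i * u x - 'i * u (x^-1)%g) = 0.
  apply/eqP; rewrite subr_eq0; apply/eqP; rewrite -[in RHS]mulNr -[RHS]ki; ring.
have h : 2 * 'i * (u (x^-1)%g - (u x)^*) = 0.
  by rewrite -[RHS](subrr 0) -{1}ki' -(mulr0 'i) -k1'; ring.
by move/eqP: h; rewrite !mulf_eq0 (negbTE i0) pnatr_eq0 /= subr_eq0 => /eqP.
Qed.

End PositiveDefinite.

Section GNS.
Variables (R : realType) (G : topGroupType).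
Notation C := (R[i] : numClosedFieldType).

Lemma GNS_exists (u : G -> C) : continuous u -> positive_definite u ->
  exists (H : hilbertType C) (pi : unitary_rep G H), is_GNS u pi.
Proof.
move=> uc upd.
have kC (x y : G) : u (x^-1 * y)%g = (u (y^-1 * x)%g)^*.
  by rewrite -(positive_definiteV upd) invgM invgK.
pose K := PdKernel kC (positive_definite_seq upd).
have K1 g (x y : G) : K (g * x)%g (g * y)%g = K x y.
  by rewrite /= invgM -mulgA mulKg.
have Kc (x y : G) : continuous (fun g => K (g * x)%g y : C).
  move=> g /=; apply: (@continuous_comp _ _ _ (fun g : G => (y^-1 * (g * x))%g) u); last exact: uc.
  by apply: cvg_mulg; [exact: cvg_cst | apply: cvg_mulg; [exact: cvg_id | exact: cvg_cst]].
have [H [phi [pi [phiE phit pphi]]]] :=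
  kernel_rep (act := fun g x => (g * x)%g) (@mul1g G) (fun g h x => esym (mulgA g h x)) K1 Kc.
exists H, pi, (phi 1%g); split.
  by apply/funext => x; rewrite /coef pphi phiE /= mulg1 invg1 mul1g.
suff -> : (fun x => pi x (phi 1%g)) = phi by [].
by apply/funext => x; rewrite pphi mulg1.
Qed.

End GNS.

Section LinearOf.
Variables (K : pzRingType) (U V : lmodType K) (f : U -> V).
(** The proof of linearity is an argument so that a linear structure can be attached to an [f] built
    inside a proof. *)
Definition linear_of of linear f := f.
Hypothesis fl : linear f.
HB.instance Definition _ := GRing.isLinear.Build K U V *:%R (linear_of fl) fl.
End LinearOf.

Section DirectSum.
Variables (R : realType) (G : topGroupType).
Notation C := (R[i] : numClosedFieldType).
Variables (I : Type) (K_ : I -> hilbertType C) (pi_ : forall i, unitary_rep G (K_ i)).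

Let X := {i : I & K_ i}.

(** Indices are compared classically and the vector is transported along the equality found, because
    [I] is an arbitrary type. *)
Definition component i (p : X) : K_ i :=
  match pselect (projT1 p = i) with
  | left e => eq_rect _ (fun j => K_ j : Type) (projT2 p) _ e
  | right _ => 0
  end.

Lemma component_eq i v : component i (existT _ i v) = v.
Proof.
rewrite /component /=; case: pselect => [e|] //.
by rewrite (Prop_irrelevance e erefl).
Qed.

Lemma component_neq i j v : j <> i -> component i (existT _ j v) = 0.
Proof. by rewrite /component /=; case: pselect. Qed.

Definition sum_act g (p : X) : X := existT _ (projT1 p) (pi_ (projT1 p) g (projT2 p)).

Lemma component_act i g p : component i (sum_act g p) = pi_ i g (component i p).
Proof.
case: p => j v; rewrite /sum_act /=.
have [e|ne] := pselect (j = i); last by rewrite !component_neq // linear0.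
by case: i / e; rewrite !component_eq.
Qed.

(** The Gram kernel that the embedded vectors of the summands will have: different summands are
    orthogonal. *)
Definition sum_kernel (p q : X) : C := dotp (component (projT1 q) p) (projT2 q).

Lemma sum_kernelC p q : sum_kernel q p = (sum_kernel p q)^*.
Proof.
case: p q => [i v] [j w]; rewrite /sum_kernel /=.
have [e|ne] := pselect (i = j).
  by case: j / e w => w; rewrite !component_eq -dotp_conj.
by rewrite !component_neq ?dotp0l ?rmorph0 // => e; apply: ne.
Qed.

Lemma sum_kernel_components (s : seq {classic I}) p q : uniq s -> (projT1 q : {classic I}) \in s ->
  sum_kernel p q = \sum_(i <- s) dotp (component i p) (component i q).
Proof.
case: q => j w us js; rewrite (big_rem _ js) /= big_seq big1 => [|i].
  by rewrite addr0 component_eq.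
rewrite mem_rem_uniq // inE => /andP[ij _].
by rewrite [component i (existT _ _ _)]component_neq ?dotp0r // => e; rewrite e eqxx in ij.
Qed.

(** Only the finitely many indices [s] occurring in [a] matter, and over them the kernel is a sum of
    Gram kernels of components. *)
Lemma sum_kernel_ge0 (a : seq (C * X)) :
  0 <= \sum_(p <- a) \sum_(q <- a) p.1 * q.1^* * sum_kernel p.2 q.2.
Proof.
pose tg (p : C * X) : {classic I} := projT1 p.2.
pose s := undup (map tg a).
have us : uniq s by exact: undup_uniq.
have split_sum p (b : seq (C * X)) : {subset map tg b <= s} ->
  \sum_(q <- b) p.1 * q.1^* * sum_kernel p.2 q.2 =
  \sum_(i <- s) \sum_(q <- b) p.1 * q.1^* * dotp (component i p.2) (component i q.2).
  rewrite exchange_big /=; elim: b => [|q b IH] sb; first by rewrite !big_nil.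
  rewrite !big_cons IH => [|i ib]; last by apply: sb; rewrite inE ib orbT.
  rewrite (sum_kernel_components p.2 us) ?mulr_sumr //.
  by apply: sb; rewrite inE eqxx.
have as_ : {subset map tg a <= s} by move=> i; rewrite mem_undup.
under eq_bigr do rewrite (split_sum _ a as_).
rewrite exchange_big /= sumr_ge0 // => i _; exact: (gram_ge0 (component i)).
Qed.

Lemma direct_sum_exists : exists (H : hilbertType C) (pi : unitary_rep G H), is_direct_sum pi_ pi.
Proof.
pose K := PdKernel sum_kernelC sum_kernel_ge0.
have act1 p : sum_act 1%g p = p.
  by case: p => i v; rewrite /sum_act /= rep_fun1.
have actM g h p : sum_act (g * h)%g p = sum_act g (sum_act h p).
  by case: p => i v; rewrite /sum_act /= rep_funM.
have actK g p q : K (sum_act g p) (sum_act g q) = K p q.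
  by rewrite /= /sum_kernel /= component_act rep_fun_dotp.
have act_cont p q : continuous (fun g => K (sum_act g p) q : C).
  move=> g /=; rewrite /sum_kernel /continuous_at.
  under eq_fun do rewrite component_act.
  by rewrite component_act; apply: cvg_dotpl; exact: rep_fun_continuous.
have [H [phi [pi [phiE phit pphi]]]] := kernel_rep act1 actM actK act_cont.
pose iota i (v : K_ i) := phi (existT _ i v).
have iota_lin i : linear (@iota i).
  (* Nothing in [phi] is linear by construction; linearity is tested against the total family, where
     the kernel gives all inner products. *)
  move=> z v w; apply: (total_ortho_eq phit) => _ [[j x] _ <-].
  rewrite dotpDr dotpZr !phiE /= /sum_kernel /=.
  by rewrite dotpDr dotpZr.
exists H, pi, (fun i => linear_of (iota_lin i)); split.
- by move=> i v w; rewrite /= /linear_of /iota phiE /= /sum_kernel /= component_eq.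
- move=> i j v w ij; rewrite /= /linear_of /iota phiE /= /sum_kernel /=.
  by rewrite component_neq // dotp0l.
- rewrite (_ : \bigcup_i _ = range phi) //.
  apply/seteqP; split => [_ [i _ [v _ <-]]|_ [[i v] _ <-]].
    by exists (existT _ i v).
  by exists i => //; exists v.
- by move=> i x v; rewrite /= /linear_of /iota pphi.
Qed.

End DirectSum.

Section BilinearOf.
Variables (K : nzRingType) (U U' V : lmodType K) (f : U -> U' -> V).
Definition bilinear_of of bilinear_for *:%R *:%R f := f.
Hypothesis fb : bilinear_for *:%R *:%R f.
HB.instance Definition _ := bilinear_isBilinear.Build K U U' V *:%R *:%R (bilinear_of fb) fb.
End BilinearOf.

Section TensorKernel.
Variables (C : numClosedFieldType) (H : hilbertType C).

Definition tensor_kernel (p q : H * H) : C := dotp p.1 q.1 * dotp p.2 q.2.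

Lemma tensor_kernelC p q : tensor_kernel q p = (tensor_kernel p q)^*.
Proof. by rewrite /tensor_kernel rmorphM /= -!dotp_conj. Qed.

(* Schur's product theorem: expand the first factors in an orthonormal system. *)
Lemma tensor_kernel_ge0 (a : seq (C * (H * H))) :
  0 <= \sum_(p <- a) \sum_(q <- a) p.1 * q.1^* * tensor_kernel p.2 q.2.
Proof.
have [n [e [oe ae]]] := gram_schmidt [seq p.2.1 | p <- a].
have -> : \sum_(p <- a) \sum_(q <- a) p.1 * q.1^* * tensor_kernel p.2 q.2 =
  \sum_(i < n) \sum_(p <- a) \sum_(q <- a)
     (p.1 * dotp p.2.1 (e i)) * (q.1 * dotp q.2.1 (e i))^* * dotp p.2.2 q.2.2.
  rewrite [RHS]exchange_big /=.
  rewrite big_seq [RHS]big_seq; apply: eq_bigr => p pa.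
  rewrite [RHS]exchange_big /=; apply: eq_bigr => q _.
  rewrite /tensor_kernel (expands_dotp q.2.1 (ae _ (map_f _ pa))) mulr_suml mulr_sumr.
  by apply: eq_bigr => i _; rewrite rmorphM /= -dotp_conj; ring.
rewrite sumr_ge0 // => i _.
have := gram_ge0 (fun y : H => y) [seq (p.1 * dotp p.2.1 (e i), p.2.2) | p <- a].
by rewrite big_map; under eq_bigr do rewrite big_map /=.
Qed.

End TensorKernel.

Section Tensor.
Variables (R : realType) (G : topGroupType).
Notation C := (R[i] : numClosedFieldType).
Variables (H : hilbertType C) (pi : unitary_rep G H).

Lemma kronecker_exists : exists (K : hilbertType C) (t : {bilinear H -> H -> K})
  (rho : unitary_rep (G * G)%type K), is_hilbert_tensor t /\ is_kronecker_rep pi t rho.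
Proof.
pose k := PdKernel (@tensor_kernelC C H) (@tensor_kernel_ge0 C H).
pose act (g : (G * G)%type) (p : H * H) := (pi g.1 p.1, pi g.2 p.2).
have act1 p : act 1%g p = p by case: p => x y; rewrite /act /= !rep_fun1.
have actM g h p : act (g * h)%g p = act g (act h p) by rewrite /act /= !rep_funM.
have actK g p q : k (act g p) (act g q) = k p q.
  by rewrite /= /tensor_kernel /= !rep_fun_dotp.
have act_cont p q : continuous (fun g => k (act g p) q : C).
  move=> g /=; rewrite /continuous_at /tensor_kernel /=; apply: cvgM; apply: cvg_dotpl.
    apply: (@continuous_comp _ _ _ fst (fun x => pi x p.1)); first exact: cvg_fst.
    exact: rep_fun_continuous.
  apply: (@continuous_comp _ _ _ snd (fun x => pi x p.2)); first exact: cvg_snd.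
  exact: rep_fun_continuous.
have [K [phi [rho [phiE phit pphi]]]] := kernel_rep act1 actM actK act_cont.
have bil : bilinear_for *:%R *:%R (fun x y => phi (x, y)).
  split=> [y z u v|x z u v]; apply: (total_ortho_eq phit) => _ [[a b] _ <-];
    rewrite dotpDr dotpZr !phiE /= /tensor_kernel /= dotpDr dotpZr; ring.
exists K, (bilinear_of bil), rho; split; first split.
- by move=> x x' y y'; rewrite /= /bilinear_of phiE.
- rewrite (_ : [set _ | _] = range phi) //; apply/seteqP; split => [_ [x [y ->]]|_ [[x y] _ <-]].
    by exists (x, y).
  by exists x, y.
- by move=> g x y; rewrite /= /bilinear_of pphi.
Qed.

End Tensor.

Section UniversalRepresentation.
Variables (R : realType) (G : topGroupType).
Notation C := (R[i] : numClosedFieldType).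

Let rep := {H : hilbertType C & unitary_rep G H}.

Lemma universal_rep_exists : exists (H : hilbertType C) (varpi : unitary_rep G H),
  is_universal_rep varpi.
Proof.
have gns (u : {u : G -> C | normalized_pd u}) : exists p : rep, is_GNS (sval u) (projT2 p).
  case: u => u [uc upd _] /=; have [H [pi Hpi]] := GNS_exists uc upd.
  by exists (existT _ H pi).
have [g gE] := choice gns.
have amp (u : {u : G -> C | normalized_pd u}) :
    exists p : rep, is_infinite_ampliation (projT2 (g u)) (projT2 p).
  have [H [pi Hpi]] := direct_sum_exists (fun _ : nat => projT2 (g u)).
  by exists (existT _ H pi).
have [s sE] := choice amp.
have [H [varpi Hv]] := direct_sum_exists (fun u => projT2 (s u)).
exists H, varpi, (fun u => projT1 (g u)), (fun u => projT1 (s u)).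
by exists (fun u => projT2 (g u)), (fun u => projT2 (s u)).
Qed.

Lemma universal_rep_coef (H : hilbertType C) (varpi : unitary_rep G H) (u : G -> C) :
  is_universal_rep varpi -> normalized_pd u -> exists xi, coef varpi xi = u.
Proof.
move=> [K_ [L_ [pi_ [sigma_ [gns amp [iota [iE _ _ iP]]]]]]] un.
pose v : {u : G -> C | normalized_pd u} := exist _ u un.
have [xi [xiE _]] := gns v; have [kappa [kE _ _ kP]] := amp v.
exists (iota v (kappa 0%N xi)); rewrite -[u]/(sval v) -xiE.
by apply/funext => x; rewrite /coef iP kP iE kE.
Qed.

End UniversalRepresentation.

(** * Traces of finite-dimensional representations *)

Section FiniteDimensional.
Variables (C : numClosedFieldType) (G : topGroupType).

Lemma mx_continuous (T : topologicalType) m n (f : T -> 'M[C]_(m, n)) :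
  (forall i j, continuous (fun x => f x i j)) -> continuous f.
Proof.
move=> fc x A [P xP PA].
have : \forall y \near x, forall ij : 'I_m * 'I_n, P ij.1 ij.2 (f y ij.1 ij.2).
  by apply: filter_forall => -[i j] /=; exact: (fc i j x _ (xP i j)).
by apply: filterS => y Py; apply: PA => i j; exact: (Py (i, j)).
Qed.

Section UnitaryMatrices.
Variables (n : nat) (p : G -> 'M[C]_n).
Hypothesis hp : is_fd_unitary_rep p.

Lemma fd_rep_coef_continuous i j : continuous (fun x => p x i j).
Proof.
move=> x; apply: (@continuous_comp _ _ _ p (fun M : 'M[C]_n => M i j)).
  by have [pc _ _] := hp; exact: pc.
exact: coord_continuous.
Qed.

Lemma fd_rep1 : p 1%g = 1%:M.
Proof.
have [_ pu pM] := hp; have := pM 1%g 1%g; rewrite mulg1.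
move/(congr1 (mulmx (invmx (p 1%g)))); rewrite mulKmx ?unitarymx_unit // mulVmx ?unitarymx_unit //.
Qed.

Lemma fd_repV x : p (x^-1)%g = map_mx Num.conj (p x)^T.
Proof.
have [_ pu pM] := hp; rewrite -invmx_unitary //.
apply: (can_inj (mulKmx (unitarymx_unit (pu x)))).
by rewrite -pM mulgV fd_rep1 mulmxV ?unitarymx_unit.
Qed.

(** The diagonal coefficient is the Gram kernel of the [k]-th columns, hence positive definite. *)
Lemma fd_rep_gram x y k : p (x^-1 * y)%g k k = \sum_l p y l k * (p x l k)^*.
Proof.
have [_ _ pM] := hp; rewrite pM fd_repV mxE; apply: eq_bigr => l _.
by rewrite !mxE mulrC.
Qed.

Lemma fd_rep_coef_pd k : normalized_pd (fun x => p x k k).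
Proof.
split; [exact: fd_rep_coef_continuous | | by rewrite fd_rep1 mxE eqxx].
move=> m c s.
have -> : \sum_i \sum_j c i * (c j)^* * p ((s j)^-1 * s i)%g k k =
    \sum_l `|\sum_i c i * p (s i) l k| ^+ 2.
  under eq_bigr do under eq_bigr do rewrite fd_rep_gram mulr_sumr.
  under eq_bigr do rewrite exchange_big.
  rewrite exchange_big /=; apply: eq_bigr => l _.
  rewrite normCK rmorph_sum /= mulr_suml; apply: eq_bigr => i _.
  by rewrite mulr_sumr; apply: eq_bigr => j _; rewrite rmorphM /=; ring.
by rewrite sumr_ge0 // => l _; rewrite exprn_ge0.
Qed.

(** The rows of a unitary matrix have norm 1, so a diagonal of ones forces all other entries to
    vanish. *)
Lemma fd_rep_diag_neq1 x : p x != 1%:M -> exists k, p x k k != 1.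
Proof.
move=> px; apply: contrapT => h; move/eqP: px; apply; apply/matrixP => i j.
have pii k : p x k k = 1.
  by apply/eqP; apply: contrapT => hk; apply: h; exists k; apply/negP.
have [_ /(_ x)/unitarymxP/matrixP/(_ i i) + _] := hp.
rewrite !mxE eqxx (bigD1 i) //= !mxE pii rmorph1 mulr1 => /eqP.
rewrite -subr_eq0 addrAC subrr add0r psumr_eq0 => [/allP h0|k _]; last first.
  by rewrite !mxE -normCK exprn_ge0.
have [->|ij] := eqVneq i j; first exact: pii.
have := h0 j (mem_index_enum _); rewrite eq_sym ij /= !mxE -normCK sqrf_eq0 normr_eq0.
by move/eqP.
Qed.

End UnitaryMatrices.

Lemma normalized_pd_conj (u : G -> C) : normalized_pd u -> normalized_pd (fun x => (u x)^*).
Proof.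
move=> [uc upd u1]; split; last by rewrite u1 rmorph1.
  by move=> x; apply: cvg_conjC; exact: uc.
move=> n c s; rewrite -[X in 0 <= X]conjCK conjC_ge0.
have := upd n (fun i => (c i)^*) s; congr (0 <= _).
rewrite rmorph_sum /=; apply: eq_bigr => i _; rewrite rmorph_sum /=; apply: eq_bigr => j _.
by rewrite !rmorphM /= !conjCK.
Qed.

End FiniteDimensional.

Section OrthonormalRepresentation.
Variables (C : numClosedFieldType) (G : topGroupType) (H : hilbertType C).
Variables (pi : unitary_rep G H) (n : nat) (e : 'I_n -> H).

Lemma rep_fun_adjoint x u v : dotp (pi x u) v = dotp u (pi (x^-1)%g v).
Proof. by rewrite -[RHS](rep_fun_dotp pi x) -rep_funM mulgV rep_fun1. Qed.

Definition basis_mx x : 'M[C]_n := \matrix_(i, j) dotp (pi x (e j)) (e i).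

Lemma basis_mx_rep : orthonormal e -> (forall x i, expands e (pi x (e i))) ->
  is_fd_unitary_rep basis_mx.
Proof.
move=> oe ee; split.
- apply: mx_continuous => i j x; rewrite /continuous_at !mxE.
  under eq_fun do rewrite mxE.
  by apply: cvg_dotpl; exact: rep_fun_continuous.
- move=> x; apply/unitarymxP/matrixP => i j; rewrite !mxE.
  rewrite eq_sym -oe -(rep_fun_dotp pi (x^-1)%g) (expands_dotp _ (ee _ _)).
  apply: eq_bigr => k _; rewrite !mxE !rep_fun_adjoint -[(dotp (e k) _)^*]dotp_conj.
  by rewrite mulrC rep_fun_adjoint.
- move=> x y; apply/matrixP => i j; rewrite !mxE rep_funM.
  rewrite rep_fun_adjoint (expands_dotp _ (ee y j)); apply: eq_bigr => k _.
  by rewrite !mxE -rep_fun_adjoint mulrC.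
Qed.

End OrthonormalRepresentation.

Section OrbitSums.
Variables (C : numClosedFieldType) (G : topGroupType) (H : hilbertType C).
Variables (pi : unitary_rep G H).

(** The span of the orbit is parametrised by lists, so that one list can be evaluated at two
    different cyclic vectors. *)
Definition orbit_sum (xi : H) (a : seq (C * G)) : H := \sum_(p <- a) p.1 *: pi p.2 xi.

Lemma orbit_sum_subspace xi : linear_subspace (range (orbit_sum xi)).
Proof.
split; first by exists [::] => //; rewrite /orbit_sum big_nil.
move=> z _ _ [a _ <-] [b _ <-]; exists ([seq (z * p.1, p.2) | p <- a] ++ b) => //.
rewrite /orbit_sum big_cat big_map /= scaler_sumr; congr (_ + _).
by apply: eq_bigr => p _; rewrite scalerA.
Qed.

Lemma orbit_sum_act xi x a :
  pi x (orbit_sum xi a) = orbit_sum xi [seq (p.1, (x * p.2)%g) | p <- a].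
Proof.
rewrite /orbit_sum linear_sum big_map; apply: eq_bigr => p _ /=.
by rewrite linearZ /= rep_funM.
Qed.

Lemma orbit_sum_dotp xi a b : dotp (orbit_sum xi a) (orbit_sum xi b) =
  \sum_(p <- a) \sum_(q <- b) p.1 * q.1^* * coef pi xi (q.2^-1 * p.2)%g.
Proof.
rewrite /orbit_sum dotp_suml; apply: eq_bigr => p _.
rewrite dotp_sumr; apply: eq_bigr => q _.
by rewrite dotpZl dotpZr mulrA /coef rep_funM (rep_fun_adjoint pi (q.2^-1)%g) invgK.
Qed.

(* The Gram matrix of finitely many vectors of the cyclic subspace has rank at
   most [n], because [xi] has the same coefficient function as a vector of
   ['cV_n]. *)
Lemma orbit_orthonormal_bound n (p : G -> 'M[C]_n) k xi : is_fd_unitary_rep p ->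
  coef pi xi = (fun x => p x k k) ->
  forall m (e : 'I_m -> H), orthonormal e -> (forall i, range (orbit_sum xi) (e i)) -> (m <= n)%N.
Proof.
move=> hp cxi m e oe eE; have [a aE] : exists a, forall i, orbit_sum xi (a i) = e i.
  suff /choice[a Ha] : forall i, exists a, orbit_sum xi a = e i by exists a.
  by move=> i; have [a _ <-] := eE i; exists a.
(* Row [i] is the combination [a i] applied to the [k]-th standard basis vector under [p]. Its Gram
   matrix is that of [e], so [W] has orthonormal rows and rank [m]. *)
pose W : 'M[C]_(m, n) := \matrix_(i, l) \sum_(q <- a i) q.1 * p q.2 l k.
have Wu : W \is unitarymx.
  apply/unitarymxP/matrixP => i j; rewrite !mxE -oe -!aE orbit_sum_dotp cxi.
  under eq_bigr do rewrite !mxE rmorph_sum /= mulr_suml.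
  rewrite exchange_big /=; apply: eq_bigr => q _.
  under eq_bigr do rewrite mulr_sumr.
  rewrite exchange_big /=; apply: eq_bigr => r _.
  rewrite (fd_rep_gram hp) mulr_sumr; apply: eq_bigr => l _.
  by rewrite rmorphM /=; ring.
by rewrite -(mxrank_unitary Wu) rank_leq_col.
Qed.

End OrbitSums.

Section TraceCoefficient.
Variables (C : numClosedFieldType) (G : topGroupType).

Lemma fd_trace n (p : G -> 'M[C]_n.+1) : is_fd_unitary_rep p ->
  traces C G (fun x => n.+1%:R^-1 * \tr (p x)).
Proof.
move=> hp; have [pc pu pM] := hp; split; last by move=> s t; rewrite !pM mxtrace_mulC.
split.
- move=> x; rewrite /continuous_at /mxtrace; apply: cvgM; first exact: cvg_cst.
  apply: cvg_big => [|i _]; first exact: add_continuous.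
  exact: fd_rep_coef_continuous.
- move=> m c s; rewrite /mxtrace.
  have -> : \sum_i \sum_j c i * (c j)^* * (n.+1%:R^-1 * \sum_i0 p ((s j)^-1 * s i)%g i0 i0) =
      n.+1%:R^-1 * \sum_k \sum_i \sum_j c i * (c j)^* * p ((s j)^-1 * s i)%g k k.
    rewrite [X in _ = _ * X]exchange_big /= mulr_sumr; apply: eq_bigr => i _.
    rewrite [X in _ = _ * X]exchange_big /= mulr_sumr; apply: eq_bigr => j _.
    by rewrite !mulr_sumr; apply: eq_bigr => k _; ring.
  rewrite mulr_ge0 ?invr_ge0 // sumr_ge0 // => k _.
  by have [_ kp _] := fd_rep_coef_pd hp k; exact: kp.
- by rewrite (fd_rep1 hp) mxtrace1 mulVf // pnatr_eq0.
Qed.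

End TraceCoefficient.

Section FiniteDimensionalTraces.
Variables (C : numClosedFieldType) (G : topGroupType) (H : hilbertType C).
Variables (pi : unitary_rep G H).

Definition conj_sum (a : seq (C * G)) := [seq (p.1^*, p.2) | p <- a].

(** Conjugating coefficients induces an antiunitary intertwiner from the cyclic subspace of [xi] to
    that of [xi']; this places the conjugate representation inside [pi]. *)
Lemma orbit_sum_conj xi xi' x a b : coef pi xi' = (fun g => (coef pi xi g)^*) ->
  dotp (pi x (orbit_sum pi xi' (conj_sum a))) (orbit_sum pi xi' (conj_sum b)) =
  (dotp (pi x (orbit_sum pi xi a)) (orbit_sum pi xi b))^*.
Proof.
move=> cE; rewrite !orbit_sum_act !orbit_sum_dotp cE rmorph_sum !big_map /=.
apply: eq_bigr => p _; rewrite rmorph_sum big_map /=; apply: eq_bigr => q _.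
by rewrite !rmorphM.
Qed.

Lemma kronecker_coef (K : hilbertType C) (t : {bilinear H -> H -> K})
    (rho : unitary_rep (G * G)%type K) n (e f : 'I_n -> H) z x y :
  is_hilbert_tensor t -> is_kronecker_rep pi t rho ->
  coef rho (z *: \sum_i t (e i) (f i)) (x, y) =
  `|z| ^+ 2 * \sum_i \sum_j dotp (pi x (e i)) (e j) * dotp (pi y (f i)) (f j).
Proof.
move=> [tE _] rE; rewrite /coef linearZ /= dotpZl dotpZr mulrA -normCK; congr (_ * _).
rewrite linear_sum dotp_suml; apply: eq_bigr => i _.
by rewrite dotp_sumr; apply: eq_bigr => j _; rewrite rE tE.
Qed.

(** The sum over [j] of [|pi x (e j) - e j|^2] is [2 n] minus the trace and its conjugate, that is
    0. *)
Lemma fixed_of_trace n (e : 'I_n -> H) x : orthonormal e ->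
  \tr (basis_mx pi e x) = n%:R -> forall i, pi x (e i) = e i.
Proof.
move=> oe tr i.
have E j : `|pi x (e j) - e j| ^+ 2 = 2 - basis_mx pi e x j j - (basis_mx pi e x j j)^*.
  rewrite normsqB -!dotp_norm rep_fun_dotp oe eqxx /= mulr1n mxE.
  by rewrite -[(dotp (pi x _) _)^*]dotp_conj; ring.
have : \sum_j `|pi x (e j) - e j| ^+ 2 = 0.
  under eq_bigr do rewrite E.
  have trE : \sum_j basis_mx pi e x j j = n%:R by exact: tr.
  have trC : \sum_j (basis_mx pi e x j j)^* = n%:R.
    by rewrite -[RHS](rmorph_nat (@Num.conj C)) -trE rmorph_sum.
  by rewrite !sumrB trE trC sumr_const card_ord -mulr_natr; ring.
move=> /eqP; rewrite psumr_eq0 => [/allP/(_ i (mem_index_enum _))|j _]; last exact: exprn_ge0.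
by rewrite /= sqrf_eq0 normr_eq0 subr_eq0 => /eqP.
Qed.

End FiniteDimensionalTraces.

Section AmenableTraces.
Variables (R : realType) (G : topGroupType).
Notation C := (R[i] : numClosedFieldType).

Lemma coef_Pmin (H : hilbertType C) (varpi : unitary_rep G H) (K : hilbertType C)
    (t : {bilinear H -> H -> K}) (rho : unitary_rep (G * G)%type K) kappa :
  is_universal_rep varpi -> is_hilbert_tensor t -> is_kronecker_rep varpi t rho ->
  Pmin C G (coef rho kappa).
Proof.
move=> hv ht hr; exists H, varpi, K, t, rho; split => //.
apply: subset_closure; exists 1%N, (fun=> 1), (fun=> coef rho kappa); split.
  by move=> _; split; [exact: ler01 | exists kappa].
by apply/funext => x; rewrite big_ord1 mul1r.
Qed.

Lemma fd_rep_amenable_trace n (p : G -> 'M[C]_n) x : is_fd_unitary_rep p -> p x <> p 1%g ->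
  exists u, amenable_traces C G u /\ u x <> 1.
Proof.
move=> hp px; rewrite (fd_rep1 hp) in px.
have [k pk] := fd_rep_diag_neq1 hp (introN eqP px).
have [H [varpi hv]] := universal_rep_exists R G.
have [K [t [rho [ht hr]]]] := kronecker_exists varpi.
have un := fd_rep_coef_pd hp k.
have [xi xiE] := universal_rep_coef hv un.
have [xi' xi'E] : exists xi', coef varpi xi' = (fun g => (coef varpi xi g)^*).
  by rewrite xiE; exact: universal_rep_coef hv (normalized_pd_conj un).
have [m [e [oe eE Ee]]] := finite_orthonormal_basis (orbit_sum_subspace varpi xi)
  (orbit_orthonormal_bound hp xiE).
have inv g i : expands e (varpi g (e i)).
  by apply: Ee; have [a _ <-] := eE i; rewrite orbit_sum_act; eexists.
have hq := basis_mx_rep oe inv; set q := basis_mx varpi e in hq.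
have xiO : range (orbit_sum varpi xi) xi.
  by exists [:: (1, 1%g)] => //; rewrite /orbit_sum big_seq1 scale1r rep_fun1.
have xi1 : dotp xi xi = 1.
  have [_ _ <-] := un; rewrite -[RHS]/((fun x => p x k k) 1%g) -xiE /coef rep_fun1 //.
have fixx : ~ varpi x xi = xi.
  move=> fx; move/eqP: pk; apply.
  by rewrite -[LHS]/((fun x => p x k k) x) -xiE /coef fx.
(* The cyclic subspace contains the unit vector [xi], so its dimension is positive and the trace can
   be normalised. *)
case: m => [|m] in e oe eE Ee inv q hq *.
  by exfalso; move: xi1; rewrite (Ee _ xiO) big_ord0 dotp0l => /eqP; rewrite eq_sym oner_eq0.
exists (fun g => m.+1%:R^-1 * \tr (q g)); split; last first.
  move=> tx; have m0 : m.+1%:R != 0 :> C by rewrite pnatr_eq0.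
  have trx : \tr (q x) = m.+1%:R.
    by apply: (mulfI (invr_neq0 m0)); rewrite mulVf.
  apply: fixx; rewrite (Ee _ xiO) linear_sum; apply: eq_bigr => i _.
  by rewrite linearZ /= (fixed_of_trace oe trx).
split; first exact: fd_trace.
have [a aE] : exists a, forall i, orbit_sum varpi xi (a i) = e i.
  suff /choice[a Ha] : forall i, exists a, orbit_sum varpi xi a = e i by exists a.
  by move=> i; have [a _ <-] := eE i; exists a.
pose f i := orbit_sum varpi xi' (conj_sum (a i)).
pose z : C := sqrtC (m.+1%:R^-1).
have z2 : `|z| ^+ 2 = m.+1%:R^-1.
  by rewrite ger0_norm ?sqrtCK // sqrtC_ge0 invr_ge0.
(* The trace of [q g] times the adjoint of [q h] is the sum of the products [q g i j * (q h i j)^*].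
   The conjugated factors are the entries of [varpi h] on the family [f]. *)
have -> : (fun g : G * G => m.+1%:R^-1 * \tr (q (g.1 * g.2^-1)%g)) =
    coef rho (z *: \sum_i t (e i) (f i)).
  apply/funext => -[g h]; rewrite (kronecker_coef e f z g h ht hr) z2; congr (_ * _).
  have [_ _ qM] := hq; rewrite qM (fd_repV hq) /mxtrace exchange_big; apply: eq_bigr => j _ /=.
  rewrite mxE; apply: eq_bigr => i _.
  rewrite !mxE; congr (_ * _); rewrite /f (orbit_sum_conj _ _ _ xi'E) !aE //.
exact: coef_Pmin hv ht hr.
Qed.

Lemma NamTr_sub_NMAP : NamTr C G `<=` NMAP C G.
Proof.
move=> x xN N [_ NM]; apply: contrapT => Nx.
have cx : coset N x <> coset N 1%g.
  by move=> /coset_eqE/nsgV; rewrite mulg1 invgK.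
have [n [rho [[rc ru rM] rx]]] := NM _ _ cx.
have hp : is_fd_unitary_rep (fun g => rho (coset N g)).
  split=> [g|g|g h]; [|exact: ru|].
    by apply: (@continuous_comp _ _ _ (coset N) rho); [exact: coset_continuous | exact: rc].
  by rewrite cosetM; exact: rM.
have [u [ua ux]] := fd_rep_amenable_trace hp rx.
by apply: ux; exact: xN ua.
Qed.

End AmenableTraces.

(** * Diagonally invariant vectors *)

Section KernelOfRepresentation.
Variables (C : numClosedFieldType) (G : topGroupType) (n : nat) (p : G -> 'M[C]_n).
Hypothesis hp : is_fd_unitary_rep p.

Fact fd_kerM x y : p x = 1%:M -> p y = 1%:M -> p (x * y)%g = 1%:M.
Proof. by have [_ _ pM] := hp; rewrite pM => -> ->; rewrite mul1mx. Qed.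

Fact fd_kerV x : p x = 1%:M -> p (x^-1)%g = 1%:M.
Proof. by move=> px; rewrite (fd_repV hp) px trmx1 map_mx1. Qed.

Fact fd_kerJ x y : p x = 1%:M -> p (y^-1 * (x * y))%g = 1%:M.
Proof.
by have [_ _ pM] := hp; rewrite !pM => ->; rewrite mul1mx -pM mulVg (fd_rep1 hp).
Qed.

Definition fd_ker : normalSubgroup G :=
  @NormalSubgroup G [set x | p x = 1%:M] (fd_rep1 hp) fd_kerM fd_kerV fd_kerJ.

Lemma fd_ker_closed : closed (fd_ker : set G).
Proof.
have -> : (fd_ker : set G) =
    \bigcap_(ij in [set: 'I_n * 'I_n])
      ((fun x => p x ij.1 ij.2) @^-1` [set (1%:M : 'M[C]_n) ij.1 ij.2]).
  apply/seteqP; split=> [x /= px [i j] _ /=|x px /=]; first by rewrite px.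
  by apply/matrixP => i j; exact: (px (i, j) I).
apply: closed_bigI => -[i j] _ /=.
have c1 : closed [set (1%:M : 'M[C]_n) i j].
  by apply: accessible_closed_set1; apply: hausdorff_accessible; exact: (@norm_hausdorff _ C).

apply: (preimage_closed _ c1) => x _; exact: fd_rep_coef_continuous.
Qed.

Lemma fd_ker_MAP : MAP C (quotient_group fd_ker).
Proof.
have prepr x : p (repr (coset fd_ker x)) = p x.
  have [_ _ pM] := hp.
  have h := coset_eqE (esym (coset_repr (coset fd_ker x))).
  have {}h : p (x^-1 * repr (coset fd_ker x))%g = 1%:M by exact: h.
  by rewrite -[repr _](mulVKg x) [LHS]pM h mulmx1.
move=> a b ab; exists n, (fun q => p (repr q)); split; last first.
  move=> pab; apply: ab; rewrite -(coset_repr a) -(coset_repr b); apply: coset_eq.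
  have [_ _ pM] := hp.
  by rewrite /= pM -pab -pM mulVg (fd_rep1 hp).
split=> [|q|x y]; have [pc pu pM] := hp; [|exact: pu|].
  apply/quotient_continuous.
  have -> : (fun q => p (repr q)) \o \pi_(quotient_group fd_ker)%qT = p.
    by apply/funext => x; exact: prepr.
  exact: pc.
by rewrite -(coset_repr x) -(coset_repr y) -[(_ * _)%g]cosetM !prepr pM.
Qed.

(** The kernel of [p] is one of the subgroups intersected in [NMAP], since [p] descends to a
    representation separating the points of the quotient. *)
Lemma NMAP_fd_rep s : NMAP C G s -> p s = 1%:M.
Proof. by move=> /(_ fd_ker); apply; split; [exact: fd_ker_closed | exact: fd_ker_MAP]. Qed.

End KernelOfRepresentation.

(** * Conjugate-linear Hilbert-Schmidt operators attached to tensors *)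

Section TensorOperator.
Variables (C : numClosedFieldType) (H K : hilbertType C) (t : {bilinear H -> H -> K}).
Hypothesis ht : is_hilbert_tensor t.
Variables (eta : K) (T : H -> H).
Hypothesis TE : forall x y, dotp y (T x) = dotp (t x y) eta.

Lemma subr_telescope (V : zmodType) (a b c d : V) : a - d = (b - c) + ((a - b) - (d - c)).
Proof.
by rewrite opprB [RHS]addrC [RHS]addrAC ![in RHS]addrA !subrK.
Qed.

Lemma dotp_inj (V : hilbertType C) (u v : V) : (forall y, dotp y u = dotp y v) -> u = v.
Proof.
move=> uv; apply/eqP; rewrite -subr_eq0; apply/eqP/dotp_eq0.
by rewrite dotpBr uv subrr.
Qed.

Lemma tensor_norm x y : `|t x y| = `|x| * `|y|.
Proof.
apply: (@pexpIrn _ 2 isT); rewrite ?nnegrE ?mulr_ge0 // exprMn -!dotp_norm.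
by have [-> _] := ht.
Qed.

Lemma tensor_op_linear z x y : T (z *: x + y) = z^* *: T x + T y.
Proof.
apply: dotp_inj => w; rewrite dotpDr dotpZr conjCK !TE.
have -> : t (z *: x + y) w = z *: t x w + t y w by rewrite linearDl linearZl_LR.
by rewrite dotpDl dotpZl.
Qed.

Lemma tensor_opZ z x : T (z *: x) = z^* *: T x.
Proof.
have T0 : T 0 = 0.
  by have := tensor_op_linear (-1) 0 0; rewrite scaler0 addr0 rmorphN rmorph1 scaleN1r addNr.
by have := tensor_op_linear z x 0; rewrite addr0 T0 addr0.
Qed.

(** The operator norm is at most the Hilbert-Schmidt norm of the tensor. With [w = T x - u],
    [|w|^2 = <t x w, eta - s>]. Here [u] is the value at [x] of the operator attached to [s]. *)
Lemma tensor_op_diff_le (s : K) x u : (forall y, dotp y u = dotp (t x y) s) ->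
  `|T x - u| <= `|x| * `|eta - s|.
Proof.
move=> uE; set w := T x - u.
have [->|w0] := eqVneq w 0; first by rewrite normr0 mulr_ge0.
have wp : 0 < `|w| by rewrite normr_gt0.
rewrite -(ler_pM2r wp) -expr2 -dotp_norm -[leLHS]ger0_norm ?dotp_ge0 //.
rewrite {2}/w dotpBr TE uE -dotpBr mulrAC -tensor_norm; exact: dotp_CS.
Qed.

Lemma tensor_op_bound x : `|T x| <= `|x| * `|eta|.
Proof.
have := @tensor_op_diff_le 0 x 0 (fun y => _); rewrite !subr0; apply.
by move=> y; rewrite !dotp0r.
Qed.

(** Compactness of [T]: [eta] is approximated by sums of elementary tensors, and [t a b] corresponds
    to the rank-one map sending [x] to [<x, a>^* b]. *)
Lemma tensor_op_approx (e : C) : 0 < e -> exists n (c : 'I_n -> C) (a b : 'I_n -> H),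
  forall x, `|T x - \sum_i (c i * (dotp x (a i))^*) *: b i| <= `|x| * e.
Proof.
move=> e0; have [tE tt] := ht.
have : closure (lin_span [set z | exists x y, z = t x y]) eta by rewrite tt.
move=> /closureP/(_ _ e0)[_ [n [c [z [zt ->]]]] etaz].
have [a ab] := choice zt; have [b abE] := choice ab.
exists n, c, a, b => x.
apply: le_trans (_ : `|x| * `|eta - \sum_i c i *: z i| <= _); last first.
  by rewrite ler_wpM2l // ltW.
apply: tensor_op_diff_le => y; rewrite !dotp_sumr; apply: eq_bigr => i _.
by rewrite !dotpZr abE tE rmorphM /= conjCK; ring.
Qed.

Lemma tensor_op_cvg (I : Type) (F : set_system I) {FF : Filter F} (f : I -> H) v :
  (forall a, dotp (f i) a @[i --> F] --> dotp v a) ->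
  (\forall i \near F, `|f i| <= 1) -> T (f i) @[i --> F] --> T v.
Proof.
move=> fv f1; apply/cvgrPdist_lt => e e0.
have v1 : 0 < `|v| + 1 by rewrite ltr_wpDl.
have e2 : 0 < e / 2 by rewrite divr_gt0.
(* With [|f i| <= 1], the two finite-rank errors add up to at most [(|v| + 1) * e4 = e / 4], leaving
   [e / 2] for the finite-rank part. *)
have e4 : 0 < e / 2 / 2 / (`|v| + 1) by rewrite !divr_gt0.
have [n [c [a [b app]]]] := tensor_op_approx e4.
pose S x := \sum_i (c i * (dotp x (a i))^*) *: b i.
have Sv : S (f i) @[i --> F] --> S v.
  apply: cvg_big => [|k _]; first exact: add_continuous.
  apply: cvgZ; last exact: cvg_cst.
  by apply: cvgM; [exact: cvg_cst | apply: cvg_conjC; exact: fv].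
move/cvgrPdist_lt : Sv => /(_ _ e2); apply: filterS2 f1 => i fi Si.
have -> : T v - T (f i) = (S v - S (f i)) + ((T v - S v) - (T (f i) - S (f i))).
  exact: subr_telescope.
apply: normD_lt_half => //.
apply: (le_lt_trans (ler_normB _ _)).
apply: le_lt_trans (lerD (app v) (app (f i))) _.
rewrite -mulrDl; apply: le_lt_trans (_ : (`|v| + 1) * (e / 2 / 2 / (`|v| + 1)) < _).
  by rewrite ler_wpM2r ?(ltW e4) // lerD2l.
rewrite mulrC divfK ?gt_eqF //.
by rewrite ltr_pdivrMr // mulr_natr mulr2n ltrDl.
Qed.

Section Eigenspace.
Variable lambda : C.
Hypothesis T_le : forall v, `|T v| ^+ 2 <= lambda * `|v| ^+ 2.
Hypothesis lambda_gt0 : 0 < lambda.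

(** The [lambda]-eigenspace of the positive operator formed by [T] and its adjoint, in weak form so
    that no adjoint has to be built. The arguments on the right are swapped because [T] is
    conjugate-linear. *)
Definition tensor_eigenspace : set H :=
  [set v | forall w, lambda * dotp v w = dotp (T w) (T v)].

Lemma eigenspace_subspace : linear_subspace tensor_eigenspace.
Proof.
have T0 : T 0 = 0 by rewrite -[0](scale0r (0 : H)) tensor_opZ rmorph0 !scale0r.
split=> [w|z u v Eu Ev w]; first by rewrite T0 dotp0l dotp0r mulr0.
by rewrite tensor_op_linear dotpDl dotpZl dotpDr dotpZr conjCK -Eu -Ev; ring.
Qed.

(** The form [d u w = lambda <u, w> - <T w, T u>] is nonnegative and vanishes at [v], so
    Cauchy-Schwarz gives [d v w = 0] for all [w]. *)
Lemma eigenspace_max v : `|v| <= 1 -> `|T v| ^+ 2 = lambda -> tensor_eigenspace v.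
Proof.
move=> v1 Tv; pose d u w : C := lambda * dotp u w - dotp (T w) (T u).
have lr : lambda^* = lambda by apply/CrealP/ger0_real/ltW.
have dDl x y w : d (x + y) w = d x w + d y w.
  have E : T (x + y) = T x + T y by rewrite -[x]scale1r tensor_op_linear rmorph1 !scale1r.
  by rewrite /d E dotpDl dotpDr; ring.
have dZl z x w : d (z *: x) w = z * d x w.
  by rewrite /d tensor_opZ dotpZl dotpZr conjCK; ring.
have dC x y : d x y = (d y x)^*.
  by rewrite /d rmorphB rmorphM /= lr -!dotp_conj.
have d0 x : 0 <= d x x by rewrite /d subr_ge0 !dotp_norm T_le.
have dv : d v v = 0.
  apply/le_anti; rewrite d0 andbT /d !dotp_norm Tv subr_le0 -[leRHS]mulr1.
  by rewrite ler_pM2l // expr_le1.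
move=> w; have := inner_CS dDl dZl dC d0 v w.
rewrite dv sqrtC0 mul0r normr_le0 subr_eq0.
by move/eqP.
Qed.

(** The vectors [t (e i) (T (e i))] divided by the square root of [lambda] are orthonormal, and each
    has inner product of squared modulus [lambda] with [eta]; Bessel bounds their number. *)
Lemma eigenspace_orthonormal_bound n (e : 'I_n -> H) : orthonormal e ->
  (forall i, tensor_eigenspace (e i)) -> n%:R * lambda <= `|eta| ^+ 2.
Proof.
move=> oe Ee; have [tE _] := ht.
have l0 : lambda != 0 by rewrite gt_eqF.
have TT i j : dotp (T (e i)) (T (e j)) = lambda * (i == j)%:R by rewrite -Ee oe eq_sym.
pose s : C := (sqrtC lambda)^-1.
have s0 : 0 <= s by rewrite invr_ge0 sqrtC_ge0 ltW.
have sr : s^* = s by apply/CrealP/ger0_real.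
have s2 : s * s = lambda^-1 by rewrite -invfM -expr2 sqrtCK.
pose g i := s *: t (e i) (T (e i)).
have og : orthonormal g.
  move=> i j; rewrite dotpZl dotpZr tE TT oe sr mulrA s2.
  by case: eqP => [_|_]; rewrite ?mulr1 ?mul1r ?mulVf ?mulr0.
apply: le_trans (bessel eta og).
have -> : \sum_i `|dotp eta (g i)| ^+ 2 = \sum_(i < n) lambda.
  apply: eq_bigr => i _; rewrite dotpZr dotp_conj -TE TT eqxx mulr1 normrM norm_conjC norm_conjC.
  by rewrite !ger0_norm ?(ltW lambda_gt0) // exprMn expr2 s2 expr2 mulKf.
by rewrite sumr_const card_ord mulr_natl.
Qed.

End Eigenspace.
End TensorOperator.

Section FixedVectors.
Variables (C : numClosedFieldType) (G : topGroupType) (H : hilbertType C).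
Variables (pi : unitary_rep G H) (A : set G).

Definition fixed_vectors : set H := [set v | forall g, A g -> pi g v = v].

Lemma fixed_vectors_subspace : linear_subspace fixed_vectors.
Proof.
split=> [g _|z u v fu fv g Ag]; first exact: linear0.
by rewrite linearD linearZ /= fu // fv.
Qed.

Lemma fixed_vectors_closed : closed fixed_vectors.
Proof.
move=> v /closureP cv g Ag; apply/eqP; rewrite -subr_eq0; apply/eqP; apply: small_eq0 => e e0.
have [a fa va] := cv _ (divr_gt0 e0 (ltr0n C 2)).
have -> : pi g v - v = pi g (v - a) - (v - a).
  by rewrite linearB /= fa // opprB addrA subrK.
apply/ltW/normB_lt_half => //.
by rewrite (isometry_norm (rep_fun_dotp pi)).
Qed.

End FixedVectors.

Section Projection.
Variables (C : numClosedFieldType) (H : hilbertType C) (S : set H).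
Hypothesis Sl : linear_subspace S.

Definition projection_of (P : H -> H) :=
  forall v, S (P v) /\ forall w, S w -> dotp w (v - P v) = 0.

Lemma subspaceB u v : S u -> S v -> S (u - v).
Proof. by move=> Su Sv; rewrite addrC -scaleN1r; apply: Sl.2. Qed.

Variables (P : H -> H).
Hypothesis PP : projection_of P.

Lemma projection_unique v a : S a -> (forall w, S w -> dotp w (v - a) = 0) -> P v = a.
Proof.
move=> Sa va; apply/eqP; rewrite -subr_eq0; apply/eqP/dotp_eq0.
have Sd : S (P v - a) by apply: subspaceB => //; exact: (PP v).1.
rewrite {2}(_ : P v - a = (v - a) - (v - P v)); last by rewrite opprB [RHS]addrC addrA subrK.
by rewrite dotpBr va // (PP v).2 // subrr.
Qed.

Lemma projection_linear : linear P.
Proof.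
move=> z u v; apply: projection_unique => [|w Sw]; first by apply: Sl.2; apply: (PP _).1.
have -> : z *: u + v - (z *: P u + P v) = z *: (u - P u) + (v - P v).
  by rewrite scalerBr opprD addrACA.
by rewrite dotpDr dotpZr !(PP _).2 // mulr0 addr0.
Qed.

Lemma projection_rep (G : topGroupType) (pi : unitary_rep G H) g :
  (forall w, S w -> S (pi g w)) -> (forall w, S w -> S (pi (g^-1)%g w)) ->
  forall v, P (pi g v) = pi g (P v).
Proof.
move=> Sg SgV v; apply: projection_unique => [|w Sw]; first exact/Sg/(PP v).1.
by rewrite -linearB -[g]invgK -rep_fun_adjoint (PP v).2 //; exact: SgV.
Qed.

End Projection.

Lemma projection_exists (R : realType) (H : hilbertType (R[i] : numClosedFieldType)) (S : set H) :
  closed S -> linear_subspace S -> exists P, projection_of S P.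
Proof.
move=> Sc Sl; suff /choice[P HP] : forall v, exists p, S p /\ forall w, S w -> dotp w (v - p) = 0.
  by exists P.
move=> v; have [|w|p [Sp pE]] := @riesz R H S (fun w => dotp w v) `|v| Sc Sl.
- by move=> z u w; rewrite dotpDl dotpZl.
- by rewrite mulrC; exact: dotp_CS.
- by exists p; split=> // w Sw; rewrite dotpBr pE // subrr.
Qed.

Section InvariantOperator.
Variables (C : numClosedFieldType) (G : topGroupType) (H K : hilbertType C).
Variables (t : {bilinear H -> H -> K}) (pi : unitary_rep G H).
Variables (rho : unitary_rep (G * G)%type K) (eta : K) (T : H -> H) (lambda : C).
Hypotheses (ht : is_hilbert_tensor t) (hr : is_kronecker_rep pi t rho).
Hypothesis TE : forall x y, dotp y (T x) = dotp (t x y) eta.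
Hypothesis eta_inv : forall g, rho (g, g) eta = eta.

Lemma tensor_op_rep g x : T (pi g x) = pi g (T x).
Proof.
apply: dotp_inj => y; rewrite TE -[g in RHS]invgK -rep_fun_adjoint TE.
rewrite -[RHS](rep_fun_dotp rho (g, g)) eta_inv hr /=; congr (dotp (t _ _) _).
by rewrite -rep_funM mulgV rep_fun1.
Qed.

Lemma eigenspace_rep g v : tensor_eigenspace T lambda v -> tensor_eigenspace T lambda (pi g v).
Proof.
move=> Ev w; rewrite rep_fun_adjoint Ev !tensor_op_rep.
by rewrite -[in LHS](rep_fun_dotp pi g) -rep_funM mulgV rep_fun1.
Qed.

Lemma eigenspace_fixed N s : 0 < lambda -> `|eta| ^+ 2 <= N%:R * lambda ->
  (forall n (p : G -> 'M[C]_n), is_fd_unitary_rep p -> p s = 1%:M) ->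
  forall v, tensor_eigenspace T lambda v -> pi s v = v.
Proof.
move=> l0 etaN hs v Ev.
have El := eigenspace_subspace TE lambda.
have bd n (e : 'I_n -> H) : orthonormal e ->
    (forall i, tensor_eigenspace T lambda (e i)) -> (n <= N)%N.
  move=> oe eE; have := le_trans (eigenspace_orthonormal_bound ht TE l0 oe eE) etaN.
  by rewrite ler_pM2r // ler_nat.
have [n [e [oe eE Ee]]] := finite_orthonormal_basis El bd.
have hq : is_fd_unitary_rep (basis_mx pi e).
  by apply: basis_mx_rep => // g i; apply/Ee/eigenspace_rep.
have tr : \tr (basis_mx pi e s) = n%:R by rewrite (hs _ _ hq) mxtrace1.
rewrite (Ee _ Ev) linear_sum; apply: eq_bigr => i _.
by rewrite linearZ /= (fixed_of_trace oe tr).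
Qed.

End InvariantOperator.

Section TopEigenvector.
Variable R : realType.
Notation C := (R[i] : numClosedFieldType).
Variables (H : hilbertType C).

(** Weak compactness of the unit ball: each [<w, f i>] has a limit along [U], and the limits form a
    functional of norm at most 1, to which [riesz] applies. *)
Lemma weak_ultralimit (I : Type) (U : set_system I) (f : I -> H) : UltraFilter U ->
  (forall i, `|f i| <= 1) ->
  exists v, `|v| <= 1 /\ forall a, dotp (f i) a @[i --> U] --> dotp v a.
Proof.
move=> UU f1.
have fle w i : `|dotp w (f i)| <= `|w|.
  apply: (le_trans (dotp_CS _ _)); rewrite -[leRHS]mulr1.
  by rewrite ler_wpM2l.
have ex w : exists l : C, dotp w (f i) @[i --> U] --> l.
  apply: (@ultra_bounded_cvg R I U (fun i => dotp w (f i)) `|w|) => //.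
  by apply: filterE => i; exact: fle.
have [psi psiE] := choice ex.
have psi_lin z u w : psi (z *: u + w) = z * psi u + psi w.
  have h : dotp (z *: u + w) (f i) @[i --> U] --> z * psi u + psi w.
    under eq_fun do rewrite dotpDl dotpZl.
    by apply: cvgD; [apply: cvgM; [exact: cvg_cst|exact: psiE] | exact: psiE].
  exact: (norm_cvg_unique (psiE _) h).
have psi_le w : `|psi w| <= 1 * `|w|.
  rewrite mul1r -subr_ge0; apply: (@cvg_ge0C R I U _ (fun i => `|w| - `|dotp w (f i)|)).
    by apply: cvgB; [exact: cvg_cst | apply: cvg_norm; exact: psiE].
  by apply: filterE => i; rewrite subr_ge0.
have [|v [_ vE]] := riesz (@closedT H) _ psi_lin psi_le; first by split.
exists v; split=> [|a].
  have [->|v0] := eqVneq v 0; first by rewrite normr0 ler01.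
  have v0' : 0 < `|v| by rewrite normr_gt0.
  rewrite -(ler_pM2r v0') -expr2 -dotp_norm vE // -[leLHS]ger0_norm ?psi_le //.
  by rewrite -vE // dotp_ge0.
have h : (dotp a (f i))^* @[i --> U] --> (psi a)^* by apply: cvg_conjC; exact: psiE.
rewrite dotp_conj vE //.
by under eq_fun do rewrite dotp_conj.
Qed.

Variables (K : hilbertType C) (t : {bilinear H -> H -> K}) (eta : K) (T : H -> H).
Hypothesis ht : is_hilbert_tensor t.
Hypothesis TE : forall x y, dotp y (T x) = dotp (t x y) eta.

(* The norm of [T] on the unit ball is attained at a weak ultralimit of a maximising
   sequence, since [T] turns bounded weak convergence into norm convergence. *)
Lemma top_eigenvector : (exists x, T x <> 0) -> exists lambda v,
  [/\ 0 < lambda, forall w, `|T w| ^+ 2 <= lambda * `|w| ^+ 2, `|v| <= 1 &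
      `|T v| ^+ 2 = lambda].
Proof.
move=> [x0 Tx0].
have [r rE] : exists r : H -> R, forall x, `|T x| ^+ 2 = ((r x)%:C)%C :> C.
  exists (fun x => complex.Re (`|T x| ^+ 2 : C)) => x.
  by rewrite RRe_real // ger0_real // exprn_ge0.
pose E := r @` [set x : H | `|x| <= 1].
have supE : has_sup E.
  split; first by exists (r 0), 0 => //=; rewrite normr0 ler01.
  exists (complex.Re (`|eta| ^+ 2 : C)) => _ [x /= x1 <-].
  rewrite -lecR -rE RRe_real; last by rewrite ger0_real // exprn_ge0.
  rewrite ler_pXn2r ?nnegrE //; apply: le_trans (tensor_op_bound ht TE x) _.
  by rewrite -[leRHS]mul1r ler_wpM2r.
have ub x : `|x| <= 1 -> r x <= sup E.
  by move=> x1; apply: ub_le_sup; [exact: supE.2 | exists x].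
pose lambda : C := ((sup E)%:C)%C.
have T_le w : `|T w| ^+ 2 <= lambda * `|w| ^+ 2.
  have [->|w0] := eqVneq w 0.
    have -> : T 0 = 0 by rewrite -[0](scale0r (0 : H)) (tensor_opZ TE) rmorph0 !scale0r.
    by rewrite !normr0 expr0n /= mulr0.
  have w0' : 0 < `|w| by rewrite normr_gt0.
  have := ub (`|w|^-1 *: w).
  rewrite normrZ ger0_norm ?invr_ge0 // mulVf ?gt_eqF // lexx => /(_ isT).
  rewrite -lecR -rE (tensor_opZ TE) normrZ norm_conjC ger0_norm ?invr_ge0 // exprMn exprVn.
  by rewrite mulrC ler_pdivrMr ?exprn_gt0.
have l0 : 0 < lambda.
  have Tp : 0 < `|T x0| by rewrite normr_gt0; apply/eqP.
  have := lt_le_trans (exprn_gt0 2 Tp) (T_le x0).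
  have [->|x00] := eqVneq x0 0; first by rewrite normr0 expr0n /= mulr0 ltxx.
  by rewrite pmulr_lgt0 // exprn_gt0 // normr_gt0.
have approx (n : nat) : exists x, `|x| <= 1 /\ sup E - n.+1%:R^-1 < r x.
  have n0 : 0 < n.+1%:R^-1 :> R by rewrite invr_gt0.
  have [_ [x x1 <-] lt] := sup_adherent n0 supE.
  by exists x.
have [x Hx] := choice approx.
(* [U] refines [\oo], so the squared norms still tend to [lambda] along it, while it supplies the
   weak limit without extracting a subsequence. *)
have [U [UU ooU]] := @ultraFilterLemma nat \oo _.
have [v [v1 vE]] := weak_ultralimit UU (fun n => (Hx n).1).
exists lambda, v; split=> //.
have Tc : T (x n) @[n --> U] --> T v.
  by apply: (tensor_op_cvg ht TE vE); apply: filterE => n; exact: (Hx n).1.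
have c1 : `|T (x n)| * `|T (x n)| @[n --> U] --> `|T v| * `|T v|.
  by apply: cvgM; apply: cvg_norm; exact: Tc.
have c2 : `|T (x n)| * `|T (x n)| @[n --> U] --> lambda.
  apply/cvgrPdist_lt => _ /posC_real[d d0 ->]; apply: ooU.
  have /cvgrPdist_lt/(_ _ d0)[N _ HN] := @cvg_harmonic R.
  exists N => // n Nn; rewrite -expr2 rE -rmorphB /=.
  have h1 := ub _ (Hx n).1; have h2 := (Hx n).2.
  have := HN n Nn; rewrite /= sub0r normrN ger0_norm ?invr_ge0 // => h3.
  rewrite ger0_norm ?ler0c ?subr_ge0 // ltcR.
  by rewrite ltrBlDr addrC -ltrBlDr; apply: le_lt_trans h2; rewrite lerD2l lerN2 ltW.
rewrite expr2; exact: (norm_cvg_unique c1 c2).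
Qed.

End TopEigenvector.

Section DiagonalInvariants.
Variables (R : realType) (G : topGroupType).
Notation C := (R[i] : numClosedFieldType).
Variables (H K : hilbertType C) (pi : unitary_rep G H) (t : {bilinear H -> H -> K}).
Variable rho : unitary_rep (G * G)%type K.
Hypotheses (ht : is_hilbert_tensor t) (hr : is_kronecker_rep pi t rho).

(** The form in which the von Neumann kernel is used; it contains [NMAP] by [NMAP_fd_rep]. *)
Definition fd_trivial : set G :=
  [set s | forall n (p : G -> 'M[C]_n), is_fd_unitary_rep p -> p s = 1%:M].

Lemma fd_trivialJ s g : fd_trivial s -> fd_trivial (g^-1 * (s * g))%g.
Proof. by move=> fs n p hp; apply: (fd_kerJ hp); exact: fs. Qed.

Definition left_trivial : set (G * G) := [set (s, 1%g) | s in fd_trivial].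

(** The diagonal normalises [left_trivial]: [(s, 1) (g, g) = (g, g) (g^-1 s g, 1)]. *)
Lemma left_trivial_diag g w : fixed_vectors rho left_trivial w ->
  fixed_vectors rho left_trivial (rho (g, g) w).
Proof.
move=> fw _ [s fs <-]; rewrite -rep_funM.
have -> : ((s, 1%g) * (g, g))%g = ((g, g) * (g^-1 * (s * g), 1))%g.
  by congr (_, _) => /=; rewrite ?mulVKg // mul1g mulg1.
by rewrite rep_funM fw //; exists (g^-1 * (s * g))%g => //; exact: fd_trivialJ.
Qed.

Lemma tensor_operator_exists (kappa : K) :
  exists T : H -> H, forall x y, dotp y (T x) = dotp (t x y) kappa.
Proof.
suff /choice[T TE] : forall x, exists v, forall y, dotp y v = dotp (t x y) kappa by exists T.
move=> x; have sT : linear_subspace [set: H] by [].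
have lin z u v : dotp (t x (z *: u + v)) kappa = z * dotp (t x u) kappa + dotp (t x v) kappa.
  by rewrite linearDr linearZr_LR dotpDl dotpZl.
have bd w : `|dotp (t x w) kappa| <= `|x| * `|kappa| * `|w|.
  by rewrite mulrAC -(tensor_norm ht); exact: dotp_CS.
have [v [_ vE]] := riesz (@closedT H) sT lin bd.
by exists v => y; exact: vE.
Qed.

Lemma natC_bound (a b : C) : 0 <= a -> 0 < b -> exists N, a <= N%:R * b.
Proof.
move=> a0 b0; have /posC_real[r r0 rE] : 0 < a / b + 1 by rewrite ltr_wpDl // divr_ge0 // ltW.
exists (Num.bound r); rewrite -ler_pdivrMr //.
apply: le_trans (_ : (r%:C)%C <= _); first by rewrite -rE lerDl.
rewrite -(rmorph_nat (real_complex R)) lecR.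
exact: ltW (archi_boundP (ltW r0)).
Qed.

(* The part of [eta] orthogonal to the vectors fixed by [left_trivial] defines a
   Hilbert-Schmidt operator commuting with [pi]. If it were nonzero, its top
   eigenspace would be a finite-dimensional subrepresentation, on which
   [fd_trivial] acts trivially. *)
Lemma diag_invariant_fixed eta s : (forall g, rho (g, g) eta = eta) -> fd_trivial s ->
  rho (s, 1%g) eta = eta.
Proof.
move=> eta_inv fs.
pose S := fixed_vectors rho left_trivial.
have Sl : linear_subspace S by exact: fixed_vectors_subspace.
have Sc : closed S by exact: fixed_vectors_closed.
have [P PP] := projection_exists Sc Sl.
suff e0 : eta - P eta = 0.
  have -> : eta = P eta by apply/eqP; rewrite -subr_eq0 e0.
  by apply: (PP eta).1; exists s.
set eta1 := eta - P eta.
have eta1_inv g : rho (g, g) eta1 = eta1.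
  rewrite linearB /= eta_inv -(projection_rep Sl PP) ?eta_inv //.
    by move=> w; exact: left_trivial_diag.
  by move=> w; exact: (@left_trivial_diag (g^-1)%g).
apply: contrapT => eta10.
have [T TE] := tensor_operator_exists eta1.
have [|lambda [v [l0 T_le v1 Tv]]] := top_eigenvector ht TE.
  apply: contrapT => nT; apply: eta10.
  apply: (total_ortho ht.2) => _ [x [y ->]]; rewrite -TE.
  suff -> : T x = 0 by exact: dotp0r.
  by apply: contrapT => Tx; apply: nT; exists x.
have Ev := eigenspace_max TE T_le l0 v1 Tv.
have [N etaN] := natC_bound (exprn_ge0 2 (normr_ge0 eta1)) l0.
have vfix g : fd_trivial g -> pi g v = v.
  by move=> fg; exact: (eigenspace_fixed ht hr TE eta1_inv l0 etaN fg Ev).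
(* The contradiction: [t v (T v)] lies in [S], hence is orthogonal to [eta1], yet its inner product
   with [eta1] is [|T v|^2 = lambda > 0]. *)
have St : S (t v (T v)).
  by move=> _ [g fg <-]; rewrite hr /= vfix // rep_fun1.
have := (PP eta).2 _ St; rewrite -/eta1 -TE dotp_norm Tv => l00.
by rewrite l00 ltxx in l0.
Qed.

End DiagonalInvariants.

(** * Property (T) *)

Section GapKernel.
Variables (C : numClosedFieldType) (G : topGroupType) (K : hilbertType C).
Variables (rho : unitary_rep (G * G)%type K) (P : K -> K).

Definition diagonal : set (G * G) := range (fun g : G => (g, g)).
Let S := fixed_vectors rho diagonal.
Hypothesis PP : projection_of S P.

Let Sl : linear_subspace S := fixed_vectors_subspace rho diagonal.

Lemma fixed_diagonal v : S v -> forall g, rho (g, g) v = v.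
Proof. by move=> Sv g; apply: Sv; exists g. Qed.

Lemma projection_diagonal g v : P (rho (g, g) v) = P v.
Proof.
have Sg h w : S w -> S (rho (h, h) w) by move=> Sw; rewrite fixed_diagonal.
rewrite (projection_rep Sl PP) //; [|exact: Sg|exact: (Sg (g^-1)%g)].
exact: fixed_diagonal (PP v).1 _.
Qed.

Definition residual v := v - P v.

Lemma projection_residual u v : dotp (P u) (residual v) = 0.
Proof. exact: (PP v).2 _ (PP u).1. Qed.

Lemma residual_projection u v : dotp (residual u) (P v) = 0.
Proof. by rewrite dotpC projection_residual rmorph0. Qed.

Lemma residual_dotp u v : dotp (residual u) (residual v) = dotp u v - dotp (P u) (P v).
Proof.
have h := projection_residual u v; have h' := residual_projection u v.
move: h h'; rewrite /residual dotpBr => h; rewrite dotpBl => h'.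
by rewrite dotpBl !dotpBr (subr0_eq h) (subr0_eq h'); ring.
Qed.

Lemma residual_rep g v : residual (rho (g, g) v) = rho (g, g) (residual v).
Proof.
by rewrite /residual linearB /= projection_diagonal (fixed_diagonal (PP v).1).
Qed.

Variable n : nat.

(* The Gram kernel of [n] copies of the orthogonal complement of the diagonally
   invariant vectors. *)
Definition gap_kernel (p q : 'I_n * K) : C :=
  (p.1 == q.1)%:R * dotp (residual p.2) (residual q.2).

Lemma gap_kernelC p q : gap_kernel q p = (gap_kernel p q)^*.
Proof. by rewrite /gap_kernel rmorphM rmorph_nat /= -dotp_conj eq_sym. Qed.

Lemma gap_kernel_ge0 (a : seq (C * ('I_n * K))) :
  0 <= \sum_(p <- a) \sum_(q <- a) p.1 * q.1^* * gap_kernel p.2 q.2.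
Proof.
pose f l (p : 'I_n * K) := (p.1 == l)%:R *: residual p.2.
have E p q : gap_kernel p q = \sum_l dotp (f l p) (f l q).
  rewrite (bigD1 p.1) //= /f eqxx scale1r dotpZr rmorph_nat eq_sym big1 ?addr0 // => l lp.
  by rewrite eq_sym (negbTE lp) scale0r dotp0l.
under eq_bigr do under eq_bigr do rewrite E mulr_sumr.
under eq_bigr do rewrite exchange_big.
by rewrite exchange_big /= sumr_ge0 // => l _; exact: gram_ge0.
Qed.

Variable kappa : 'I_n -> K.

Definition coef_sum p := \sum_i coef rho (kappa i) p.

Section GapRepresentation.
Variables (H : hilbertType C) (phi : 'I_n * K -> H) (sigma : unitary_rep G H).
Hypothesis phiE : forall p q, dotp (phi p) (phi q) = gap_kernel p q.
Hypothesis phi_total : total (range phi).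
Hypothesis sigmaE : forall g p, sigma g (phi p) = phi (p.1, rho (g, g) p.2).

(** The orthogonal sum of the residuals of the [kappa i], one in each copy; its squared norm
    controls the whole of [coef_sum] at once. *)
Definition gap_vector := \sum_i phi (i, kappa i).

Lemma gap_vector_dotp g : dotp (sigma g gap_vector) gap_vector =
  coef_sum (g, g) - \sum_i dotp (P (kappa i)) (P (kappa i)).
Proof.
rewrite /gap_vector linear_sum dotp_suml /coef_sum -sumrB; apply: eq_bigr => i _.
rewrite dotp_sumr (bigD1 i) //= sigmaE phiE /gap_kernel /= eqxx mul1r.
rewrite residual_dotp projection_diagonal big1 ?addr0 // => j ji.
by rewrite phiE /gap_kernel /= eq_sym (negbTE ji) mul0r.
Qed.

Lemma gap_vector_norm : `|gap_vector| ^+ 2 = \sum_i `|residual (kappa i)| ^+ 2.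
Proof.
rewrite -dotp_norm -[X in dotp X _](rep_fun1 sigma) gap_vector_dotp -sumrB.
by apply: eq_bigr => i _; rewrite -dotp_norm residual_dotp /coef rep_fun1.
Qed.

(** The contributions of the [P (kappa i)] cancel, because these vectors do not move under the
    diagonal. Only values of the approximant on the diagonal remain. *)
Lemma gap_vector_displacement g : `|sigma g gap_vector - gap_vector| ^+ 2 =
  2 * coef_sum (1, 1)%g - coef_sum (g, g) - (coef_sum (g, g))^*.
Proof.
have E1 : dotp gap_vector gap_vector = coef_sum (1, 1)%g - \sum_i dotp (P (kappa i)) (P (kappa i)).
  by rewrite -gap_vector_dotp rep_fun1.
have E2 : (\sum_i dotp (P (kappa i)) (P (kappa i)))^* = \sum_i dotp (P (kappa i)) (P (kappa i)).
  by apply/CrealP/ger0_real; rewrite sumr_ge0 // => i _; exact: dotp_ge0.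
rewrite normsqB -!dotp_norm rep_fun_dotp [dotp gap_vector (sigma g _)]dotpC.
by rewrite gap_vector_dotp E1 rmorphB /= E2; ring.
Qed.

Lemma gap_point_linear i : linear (fun v => phi (i, v)).
Proof.
move=> z u v; apply: (total_ortho_eq phi_total) => _ [[j w] _ <-].
rewrite dotpDr dotpZr !phiE /gap_kernel /=.
have -> : residual (z *: u + v) = z *: residual u + residual v.
  by rewrite /residual (projection_linear Sl PP) opprD addrACA scalerBr.
by rewrite dotpDr dotpZr; ring.
Qed.

Lemma gap_point_norm i v : `|phi (i, v)| <= `|v|.
Proof.
rewrite -(@ler_pXn2r _ 2 isT) ?nnegrE // -!dotp_norm phiE /gap_kernel /= eqxx mul1r.
by rewrite residual_dotp lerBlDr lerDl dotp_ge0.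
Qed.

(** The pullback [w] of an invariant [psi] to the [i]-th copy is diagonally invariant, so its
    residual is 0 and [phi (i, w) = 0]; then [<w, w> = <phi (i, w), psi> = 0]. The pullbacks are
    later supplied by [riesz]. *)
Lemma gap_no_invariants psi : (forall i, exists w, forall v, dotp v w = dotp (phi (i, v)) psi) ->
  (forall g, sigma g psi = psi) -> psi = 0.
Proof.
move=> ex inv; apply: (total_ortho phi_total) => _ [[i v] _ <-].
have [w wE] := ex i; suff w0 : w = 0 by rewrite -wE w0 dotp0r.
have Sw : S w.
  move=> _ [g _ <-]; apply: dotp_inj => y.
  have -> : dotp y (rho (g, g) w) = dotp (rho ((g, g)^-1)%g y) w by rewrite rep_fun_adjoint invgK.
  rewrite !wE -[RHS](rep_fun_dotp sigma (g^-1)%g) sigmaE /=.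
  by rewrite -{2}(inv g) -rep_funM mulVg rep_fun1.
have Pw : residual w = 0.
  rewrite /residual (projection_unique Sl PP Sw) ?subrr // => y _.
  by rewrite ?subrr dotp0r.
apply: dotp_eq0; rewrite wE.
suff -> : phi (i, w) = 0 by rewrite dotp0l.
by apply: dotp_eq0; rewrite phiE /gap_kernel /= Pw dotp0l mulr0.
Qed.

(** Both [P (kappa i)] and its orthogonality to the residual survive [rho (s, 1)], so only the
    residuals change, each by at most twice its squared norm. *)
Lemma coef_sum_left s : (forall eta, S eta -> rho (s, 1%g) eta = eta) ->
  `|coef_sum (s, 1%g) - coef_sum (1, 1)%g| <= 2 * `|gap_vector| ^+ 2.
Proof.
move=> hs; rewrite /coef_sum -sumrB gap_vector_norm mulr_sumr.
apply: (le_trans (ler_norm_sum _ _ _)); apply: ler_sum => i _.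
set r := rho (s, 1%g); set v := kappa i; rewrite /coef rep_fun1.
have rP : r (P v) = P v by apply: hs; exact: (PP v).1.
have -> : dotp (r v) v - dotp v v =
    dotp (r (residual v)) (residual v) - dotp (residual v) (residual v).
  have E : v = P v + residual v by rewrite addrC subrK.
  have rE : r v = P v + r (residual v) by rewrite {1}E linearD /= rP.
  have h : dotp (r (residual v)) (P v) = 0.
    by rewrite -{1}rP rep_fun_dotp residual_projection.
  have h1 : dotp (r v) v = dotp (P v + r (residual v)) (P v + residual v) by rewrite -rE -E.
  have h2 : dotp v v = dotp (P v + residual v) (P v + residual v) by rewrite -E.
  rewrite h1 h2; move: (projection_residual v v) (residual_projection v v) h.
  by move: (residual v) => d q1 q2 h; rewrite !dotpDl !dotpDr h q1 q2; ring.
apply: (le_trans (ler_normB _ _)).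
rewrite mulr_natl mulr2n lerD //; last by rewrite dotp_norm ger0_norm ?exprn_ge0.
apply: (le_trans (dotp_CS _ _)).
by rewrite (isometry_norm (rep_fun_dotp rho)) expr2.
Qed.

End GapRepresentation.
End GapKernel.

Lemma closure_compact_approx (C : numFieldType) (U : topologicalType)
    (A : set (U -> C)) (f : U -> C) (Q : set U) (e : C) :
  closure (A : set {family compact, U -> C}) f -> compact Q -> 0 < e ->
  exists2 g, A g & forall y, Q y -> `|f y - g y| < e.
Proof.
move=> cA cQ e0.
have entE : entourage [set xy : C * C | ball xy.1 e xy.2].
  by rewrite -entourage_ballE; exists e.
have := cA _ (@fam_nbhs U C compact Q _ f entE cQ).
by move=> [g [Ag gQ]]; exists g; [exact: Ag | exact: gQ].
Qed.

Section SpectralGap.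
Variables (R : realType) (G : topGroupType).
Notation C := (R[i] : numClosedFieldType).
Variables (Q : set G) (e : C).
Hypothesis e0 : 0 < e.
Hypothesis kazhdan : forall (H : hilbertType C) (pi : unitary_rep G H),
  (exists xi : H, xi <> 0 /\ forall x, Q x -> `|pi x xi - xi| < e * `|xi|) ->
  exists eta : H, eta <> 0 /\ forall x, pi x eta = eta.

(** The squared displacement of the gap vector [Phi] on [Q] is at most [4 d]. If [e^2 |Phi|^2]
    exceeded this, [Phi] would produce a nonzero invariant vector. The remaining factor 2 in [8 * d]
    is that of [coef_sum_left]. *)
Lemma gap_estimate (K : hilbertType C) (rho : unitary_rep (G * G)%type K)
    n (kappa : 'I_n -> K) (d : C) s :
  `|coef_sum rho kappa (1, 1)%g - 1| < d ->
  (forall q, Q q -> `|coef_sum rho kappa (q, q) - 1| < d) ->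
  (forall eta, (forall g, rho (g, g) eta = eta) -> rho (s, 1%g) eta = eta) ->
  e ^+ 2 * `|coef_sum rho kappa (s, 1%g) - coef_sum rho kappa (1, 1)%g| <= 8 * d.
Proof.
move=> d1 dQ hs.
pose S := fixed_vectors rho (@diagonal G).
have Sl : linear_subspace S by exact: fixed_vectors_subspace.
have Sc : closed S by exact: fixed_vectors_closed.
have [P PP] := projection_exists Sc Sl.
pose k := PdKernel (@gap_kernelC C K P n) (@gap_kernel_ge0 C K P n).
pose act g (p : 'I_n * K) := (p.1, rho (g, g) p.2).
have act1 p : act 1%g p = p by case: p => i v; rewrite /act /= (rep_fun1 rho).
have actM g h p : act (g * h)%g p = act g (act h p).
  by rewrite /act /= -(rep_funM rho (g, g) (h, h)).
have actK g p q : k (act g p) (act g q) = k p q.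
  by rewrite /= /gap_kernel /= !(residual_rep PP) rep_fun_dotp.
have act_cont p q : continuous (fun g => k (act g p) q : C).
  move=> g /=; rewrite /continuous_at /gap_kernel /=.
  apply: cvgM; first exact: cvg_cst.
  under eq_fun do rewrite (residual_rep PP).
  rewrite (residual_rep PP); apply: cvg_dotpl.
  apply: (@continuous_comp _ _ _ (fun g : G => (g, g)) (fun p => rho p _)).
    by apply: cvg_pair; exact: cvg_id.
  exact: rep_fun_continuous.
have [H [phi [sigma [phiE phit sigmaE]]]] := kernel_rep act1 actM actK act_cont.
pose Phi := gap_vector kappa phi.
have no_inv psi : (forall g, sigma g psi = psi) -> psi = 0.
  apply: (gap_no_invariants PP phiE phit sigmaE) => i.
  have lin z u v : dotp (phi (i, z *: u + v)) psi =
      z * dotp (phi (i, u)) psi + dotp (phi (i, v)) psi.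
    by rewrite (gap_point_linear PP phiE phit) dotpDl dotpZl.
  have bd w : `|dotp (phi (i, w)) psi| <= `|psi| * `|w|.
    rewrite mulrC; apply: (le_trans (dotp_CS _ _)); rewrite ler_wpM2r //.
    exact: (gap_point_norm PP phiE).
  have sT : linear_subspace [set: K] by [].
  have [w [_ wE]] := riesz (@closedT K) sT lin bd.
  by exists w => v; exact: wE.
have Phi_le : e ^+ 2 * `|Phi| ^+ 2 <= 4 * d.
  have d0 : 0 < d by apply: le_lt_trans d1.
  rewrite real_leNgt ?ger0_real ?mulr_ge0 ?exprn_ge0 ?(ltW e0) ?(ltW d0) //.
  apply/negP => dlt; have [|eta [eta0 /no_inv]] := kazhdan (pi := sigma); last exact: eta0.
  exists Phi; split=> [Phi0|q Qq].
    by have := lt_trans (mulr_gt0 (ltr0n C 4) d0) dlt; rewrite Phi0 normr0 expr0n mulr0 ltxx.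
  rewrite -(@ltr_pXn2r _ 2 isT) ?nnegrE ?mulr_ge0 ?(ltW e0) // exprMn.
  apply: le_lt_trans dlt.
  rewrite -[leLHS]ger0_norm ?exprn_ge0 // (gap_vector_displacement PP kappa phiE sigmaE).
  set a := coef_sum _ _ (1, 1)%g; set b := coef_sum _ _ (q, q).
  (* Four terms, each of modulus at most [d]: this is the constant 4. *)
  have -> : 2 * a - b - b^* = (a - 1 + (a - 1)) - ((b - 1) + (b - 1)^*).
    by rewrite rmorphB rmorph1; ring.
  have b1 : `|(b - 1)^*| <= d by rewrite norm_conjC ltW // dQ.
  have b2 : `|b - 1| <= d by rewrite ltW // dQ.
  have a1 : `|a - 1| <= d by exact: ltW.
  apply: (le_trans (ler_normB _ _)).
  have -> : 4 * d = (d + d) + (d + d) by ring.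
  by apply: lerD; apply: (le_trans (ler_normD _ _)); apply: lerD.
apply: le_trans (_ : e ^+ 2 * (2 * `|Phi| ^+ 2) <= _).
  rewrite ler_wpM2l ?exprn_ge0 ?(ltW e0) //.
  apply: (coef_sum_left PP kappa phiE sigmaE) => eta Seta.
  by apply: hs => g; exact: fixed_diagonal.
rewrite mulrCA; apply: le_trans (_ : 2 * (4 * d) <= _); first by rewrite ler_wpM2l.
by rewrite mulrA -natrM.
Qed.

End SpectralGap.

Section PropertyT.
Variables (R : realType) (G : topGroupType).
Notation C := (R[i] : numClosedFieldType).

(** The nonnegative weights are absorbed into the vectors through their square roots. *)
Lemma cone_gen_coef (K : hilbertType C) (rho : unitary_rep (G * G)%type K) g :
  cone_gen (range (coef rho)) g -> exists n (kappa : 'I_n -> K), g = coef_sum rho kappa.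
Proof.
move=> [n [a [h [ah ->]]]].
have [v vE] : exists v : 'I_n -> K, forall i, coef rho (v i) = h i.
  suff /choice[v Hv] : forall i, exists v, coef rho v = h i by exists v.
  by move=> i; have [_ [v _ <-]] := ah i; exists v.
exists n, (fun i => sqrtC (a i) *: v i); apply/funext => p; apply: eq_bigr => i _.
rewrite -vE /coef linearZ /= dotpZl dotpZr mulrA -normCK ger0_norm ?sqrtCK //.
by rewrite sqrtC_ge0; have [] := ah i.
Qed.

Lemma NMAP_sub_NamTr : property_T C G -> NMAP C G `<=` NamTr C G.
Proof.
move=> [Q [cQ [e e0 kazhdan]]] s sN u [[[uc upd u1] utr] [H [varpi [K [t [rho [_ ht hr cl]]]]]]].
have fs : fd_trivial R s by move=> n p hp; exact: (NMAP_fd_rep hp sN).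
apply/eqP; rewrite -subr_eq0; apply/eqP; apply: contrapT => /eqP us.
have us0 : 0 < `|u s - 1| by rewrite normr_gt0.
(* Two approximation errors and [gap_estimate] yield [e^2 |u s - 1| <= 2 e^2 d + 8 d = M d]. The
   choice of [d] makes [M d] half of the left side, which is absurd. *)
pose M := 2 * e ^+ 2 + 8.
have M0 : 0 < M by rewrite ltr_wpDl // mulr_ge0 // exprn_ge0 // ltW.
pose d := e ^+ 2 * `|u s - 1| / 2 / M.
have d0 : 0 < d by rewrite !divr_gt0 // mulr_gt0 // exprn_gt0.
(* On the diagonal [u (g g^-1) = 1], which makes the approximant almost invariant over [Q]; the
   point [(1, 1)] normalises it and [(s, 1)] recovers [u s]. *)
pose Q' : set (G * G) := ((fun g => (g, g)) @` Q) `|` ([set (1, 1)%g] `|` [set (s, 1%g)]).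
have cQ' : compact Q'.
  apply: compactU; last by apply: compactU; exact: compact_set1.
  apply: continuous_compact => //; apply: continuous_subspaceT => g.
  by apply: cvg_pair; exact: cvg_id.
have [g /cone_gen_coef[n [kappa gE]] Hg] := closure_compact_approx cl cQ' d0.
rewrite gE in Hg.
have h1 : `|coef_sum rho kappa (1, 1)%g - 1| < d.
  have := Hg (1, 1)%g (or_intror (or_introl erefl)).
  by rewrite /= invg1 mulg1 u1 distrC.
have hQ q : Q q -> `|coef_sum rho kappa (q, q) - 1| < d.
  move=> Qq; have := Hg (q, q) (or_introl (ex_intro2 _ _ q Qq erefl)).
  by rewrite /= mulgV u1 distrC.
have hs : `|u s - coef_sum rho kappa (s, 1%g)| < d.
  have := Hg (s, 1%g) (or_intror (or_intror erefl)).
  by rewrite /= invg1 mulg1.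
have inv eta : (forall g, rho (g, g) eta = eta) -> rho (s, 1%g) eta = eta.
  by move=> eta_inv; exact: (diag_invariant_fixed ht hr eta_inv fs).
have gap := gap_estimate e0 kazhdan h1 hQ inv.
have : e ^+ 2 * `|u s - 1| <= M * d.
  have -> : u s - 1 = (u s - coef_sum rho kappa (s, 1%g)) +
    ((coef_sum rho kappa (s, 1%g) - coef_sum rho kappa (1, 1)%g) +
     (coef_sum rho kappa (1, 1)%g - 1)) by ring.
  set gap_s := `|coef_sum rho kappa (s, 1%g) - _| in gap.
  apply: le_trans (_ : e ^+ 2 * (d + (gap_s + d)) <= _).
    rewrite ler_wpM2l ?exprn_ge0 ?(ltW e0) //.
    apply: (le_trans (ler_normD _ _)); apply: lerD; first exact: ltW.
    by apply: (le_trans (ler_normD _ _)); apply: lerD => //; exact: ltW.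
  rewrite [leLHS](_ : _ = 2 * e ^+ 2 * d + e ^+ 2 * gap_s); last by ring.
  by rewrite /M [leRHS]mulrDl lerD2l.
rewrite /d [M * _]mulrC divfK ?gt_eqF // ler_pdivlMr // -[leRHS]mulr1.
by rewrite ler_pM2l ?mulr_gt0 ?exprn_gt0 // lern1.
Qed.

End PropertyT.

Theorem theorem5p4 (R : realType) (G : topGroupType)
    (hG : locally_compact_group G) (hT : property_T R[i] G) :
  NamTr R[i] G = NMAP R[i] G.
Proof.
by apply/seteqP; split; [exact: NamTr_sub_NMAP | exact: NMAP_sub_NamTr].
Qed.
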